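(* Let $f:\mathbb{N}_0\to(0,\infty)$ be non-decreasing and suppose there exists $C_f>0$ such that $f(i)\le C_f(i+1)$ for all $i\ge 0$. Suppose $\Phi_2(\infty)<\infty$. Let $\{m_i\}_{i\ge1}$ be a (possibly random) $\mathbb{N}$-valued attachment sequence, put $s_n=\sum_{i=1}^n m_i$, and suppose that, almost surely, $$\limsup_{n\to\infty}\frac{\Phi_1(m_n)}{\log s_n}\le\frac{1}{8C_f}.$$ Then a persistent hub emerges almost surely in the random graph sequence $\{\mathcal{G}_n\}_{n\ge0}$ with attachment function $f$ and attachment sequence $\{m_i\}_{i\ge1}$.
   Context: $\mathbb{N}=\{1,2,\dots\}$, $\mathbb{N}_0=\mathbb{N}\cup\{0\}$. For $k=1,2$ and $l\in\mathbb{N}_0$, $\Phi_k(l)=\sum_{i=0}^{l-1}f(i)^{-k}$, and $\Phi_k(\infty)=\lim_{l\to\infty}\Phi_k(l)$. Standing assumptions on attachment functions: $\inf_{i\ge0}f(i)>0$ and $\sum_{i\ge0}1/f(i)=\infty$. Model. Conditionally on a realization of $\{m_i\}_{i\ge1}$, the random graphs $\mathcal{G}_n$ are built as follows. $\mathcal{G}_0$ consists of one vertex $v_0$ and no edges. Given $\mathcal{G}_{n-1}$ (with vertices $v_0,\dots,v_{n-1}$), $\mathcal{G}_n$ is obtained by adding one vertex $v_n$ and $m_n$ edges directed away from $v_n$; the other ends of these edges are attached sequentially, each one to a vertex $v_i$, $0\le i\le n-1$, chosen with (conditional) probability $f(\deg v_i)/\sum_{j=0}^{n-1}f(\deg v_j)$,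 where degrees are computed immediately before that edge is attached (so they account for the edges of $v_n$ already attached). Multiple edges are allowed. Degree means in-degree plus out-degree. A persistent hub emerges if, almost surely, there is a random finite $n_0\in\mathbb{N}_0$ such that the same vertex has maximal degree in $\mathcal{G}_n$ for all $n\ge n_0$. *)

(* Defs.v *)
From HB Require Import structures.
From mathcomp Require Import all_boot all_order all_algebra.
From mathcomp Require Import all_classical all_reals all_analysis.
Import Order.TTheory GRing.Theory Num.Theory.
Import numFieldNormedType.Exports.

Set Implicit Arguments.
Unset Strict Implicit.
Unset Printing Implicit Defensive.

Local Open Scope classical_set_scope.
Local Open Scope ring_scope.

Section AttachmentFunction.
Context {R : realType}.
Implicit Type f : nat -> R.

Definition Phi f (k l : nat) : R := \sum_(0 <= i < l) f i ^- k.

Definition Phi_infty f (k : nat) : \bar R := limn (fun l => (Phi f k l)%:E).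

Definition attachment_function f : Prop :=
  0 < inf (range f) /\ Phi_infty f 1 = +oo%E.

End AttachmentFunction.

(* A directed multigraph is given by its list of edges (source, target), in the
   order in which they were attached; vertex v_i is the natural number i. *)
Definition multigraph := seq (nat * nat).

Definition outdeg (E : multigraph) (v : nat) : nat :=
  count (fun e => e.1 == v) E.

Definition indeg (E : multigraph) (v : nat) : nat :=
  count (fun e => e.2 == v) E.

Definition degree (E : multigraph) (v : nat) : nat :=
  (indeg E v + outdeg E v)%N.

(* Probability that the next edge issued by v_(n+1) is attached to v_i, for
   0 <= i <= n, when E lists all the edges attached so far. *)
Definition attach_prob {R : realType} (f : nat -> R) (E : multigraph)
    (n i : nat) : R :=
  f (degree E i) / \sum_(0 <= j < n.+1) f (degree E j).

Section ConditionalProbability.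
Context {d : measure_display} {T : measurableType d} {R : realType}.

(* Y is a version of the conditional probability of A given the sub-sigma-
   algebra G. *)
Definition is_cond_prob (P : probability T R) (G : set (set T)) (A : set T)
    (Y : T -> R) : Prop :=
  (forall B : set R, measurable B -> G (Y @^-1` B)) /\
  (forall B : set T, G B -> P (A `&` B) = (\int[P]_(w in B) (Y w)%:E)%E).

End ConditionalProbability.

Section Model.
Context {d : measure_display} {T : measurableType d} {R : realType}.
Context {P : probability T R}.

(* For i >= 1, [m i] is the number of edges issued by v_i ([m 0] plays no role);
   [X i k] is the target of the edge number k of v_i, counting from 0, and is
   relevant only for k < m i. *)
Variables (m : nat -> {RV P >-> nat}) (X : nat -> nat -> {RV P >-> nat}).

Fixpoint graph (n : nat) (w : T) : multigraph :=
  if n is n'.+1 then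
    graph n' w ++ [seq (n'.+1, X n'.+1 k w) | k <- iota 0 (m n'.+1 w)]
  else [::].

(* The edges of G_n followed by the first k edges of v_(n+1). *)
Definition partial_graph (n k : nat) (w : T) : multigraph :=
  graph n w ++ [seq (n.+1, X n.+1 l w) | l <- iota 0 k].

(* The information given by the whole sequence (m i)_(i >= 1) and by all the
   edges attached before the edge number k of v_(n+1). *)
Definition history (n k : nat) : set (set T) :=
  <<s [set A | (exists i b, (0 < i)%N /\ A = m i @^-1` [set b]) \/
               (exists E, A = partial_graph n k @^-1` [set E])] >>.

(* The conditional law of the edge number k of v_(n+1); the event that this edge
   exists, k < m (n+1), belongs to [history n k]. *)
Definition preferential_attachment (f : nat -> R) : Prop :=
  forall n k i : nat, (i <= n)%N ->
    is_cond_prob P (history n k)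
      [set w | (k < m n.+1 w)%N /\ X n.+1 k w = i]
      (fun w => if (k < m n.+1 w)%N
                then attach_prob f (partial_graph n k w) n i else 0).

Definition partial_sum (n : nat) (w : T) : nat :=
  (\sum_(1 <= i < n.+1) m i w)%N.

(* The vertices of G_n are v_0, ..., v_n. *)
Definition has_max_degree (n : nat) (w : T) (v : nat) : Prop :=
  (v <= n)%N /\
  forall u, (u <= n)%N -> (degree (graph n w) u <= degree (graph n w) v)%N.

Definition persistent_hub : Prop :=
  {ae P, forall w, exists n0 v : nat,
    forall n, (n0 <= n)%N -> has_max_degree n w v}.

End Model.

(* Main.v *)
Require Import Defs.
From HB Require Import structures.
From mathcomp Require Import all_boot all_order all_algebra.
From mathcomp Require Import all_classical all_reals all_analysis.
From mathcomp Require Import ring lra zify.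
Import Order.TTheory GRing.Theory Num.Theory.
Import numFieldNormedType.Exports.

(** When an edge is attached while the total weight of the graph is S, a vertex
    of degree a is hit with probability f(a)/S, and a hit increases Phi_1 of its
    degree by 1/f(a). So Phi_1 of the degree of every vertex grows at the same
    mean rate 1/S, and the squares of its jumps add up to at most Phi_2(oo),
    which is finite. The sum of the 1/S is the clock below. Two consequences give
    the theorem.

    Late vertices never lead. Phi_1(degree) minus the clock has exponential
    tails that are uniform over the vertices and over the sequence of the m_i
    ([exp_dev_supermartingale], [expect_deviates_le]). Hence the oldest vertex
    follows the clock up to a random constant ([ae_Phi_clock]), and, by
    Borel-Cantelli, all but finitely many vertices v_n exceed the value that
    they would have by following the clock from their birth on by less than
    log(s_n)/(24 Cf) ([ae_upper_deviation]). As f is at most linear, the clock at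
    the birth of v_n is at least log(s_n)/(3 Cf) ([clock_ge]), whereas v_n is born
    with Phi_1(m_n), which is at most log(s_n)/(4 Cf) for large n. Since
    1/4 + 1/24 < 1/3, v_n remains behind v_0 for ever once n is large
    ([late_vertices_below]).

    Two vertices tie finitely often. The difference M of the Phi_1 of their
    degrees is a martingale with a total quadratic variation that is fixed at
    each tie: the sum of f(i)^-2 over the degrees i still ahead, once for each of
    the two vertices. A bound on the
    fourth moment then makes the probability that M does not return to 0 at a
    large degree bounded below ([first_tie_escape]). If ties at unbounded degrees
    had a positive probability p, then late ties would occur with a probability
    close to p and be followed by an escape on an event of probability close to
    0, which contradicts this bound ([ae_finitely_many_ties]). As degrees tend to
    infinity and the difference of two degrees changes by at most 1 at a time, the
    order of two vertices is eventually constant, so that one of the finitely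
    many competing vertices eventually dominates the others
    ([hub_of_eventual_order]).

    The probabilistic estimates are made for a fixed sequence of the sources of
    the edges, where they are inequalities between finite sums proved by
    induction on this sequence ([expect]). Conditioning on the countably many
    values of the sources up to a given vertex transfers them to the model
    ([atom_expect], [probability_graph_le]). *)

Set Implicit Arguments.
Unset Strict Implicit.
Unset Printing Implicit Defensive.

Local Open Scope classical_set_scope.
Local Open Scope ring_scope.

(** * Prefixes and degrees of an edge list *)

Lemma degree_rcons E a i v :
  degree (rcons E (a, i)) v = (degree E v + (i == v) + (a == v))%N.
Proof. by rewrite /degree /indeg /outdeg -!cats1 !count_cat /=; lia. Qed.

Lemma degree_take_le j E v : (degree (take j E) v <= degree E v)%N.
Proof.
by rewrite -{2}(cat_take_drop j E) /degree /indeg /outdeg !count_cat; lia.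
Qed.

(** The event that some intermediate state of the growing graph satisfies [Q]: the
    edges are listed in the order of attachment, so the intermediate states are the
    prefixes. *)
Definition ever (Q : pred multigraph) (E : multigraph) : bool :=
  has (fun j => Q (take j E)) (iota 0 (size E).+1).

Lemma everP (Q : pred multigraph) E :
  reflect (exists2 j, (j <= size E)%N & Q (take j E)) (ever Q E).
Proof.
apply: (iffP hasP) => -[j]; first by rewrite mem_iota add0n ltnS; exists j.
by move=> jE Qj; exists j => //; rewrite mem_iota add0n ltnS.
Qed.

Lemma ever_nil (Q : pred multigraph) : ever Q [::] = Q [::].
Proof. by rewrite /ever /= orbF. Qed.

Lemma ever_rcons (Q : pred multigraph) E e :
  ever Q (rcons E e) = ever Q E || Q (rcons E e).
Proof.
apply/everP/orP => [[j]|[/everP[j jE Qj]|Qe]].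
- rewrite size_rcons leq_eqVlt => /orP[/eqP-> |].
    by rewrite -(size_rcons E e) take_size; right.
  rewrite ltnS => jE; rewrite -cats1 takel_cat// => Qj.
  by left; apply/everP; exists j.
- exists j; first by rewrite size_rcons; lia.
  by rewrite -cats1 takel_cat.
- by exists (size (rcons E e)) => //; rewrite take_size.
Qed.

Lemma ever_cat (Q : pred multigraph) E F : ever Q E -> ever Q (E ++ F).
Proof.
move=> /everP[j jE Qj]; apply/everP; exists j; first by rewrite size_cat; lia.
by rewrite takel_cat.
Qed.

Lemma ever_now (Q : pred multigraph) E : Q E -> ever Q E.
Proof. by move=> QE; apply/everP; exists (size E) => //; rewrite take_size. Qed.

(** * Expectation over the targets when the sources are given *)

Section Walk.
Context {R : realType} (f : nat -> R) (f_gt0 : forall i, 0 < f i).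
Implicit Types (E F : multigraph) (ss : seq nat).

Definition weight E n : R := \sum_(0 <= j < n.+1) f (degree E j).

Lemma weight_gt0 E n : 0 < weight E n.
Proof.
rewrite /weight big_nat_recl//= ltr_pwDl// sumr_ge0// => i _; exact: ltW.
Qed.

Lemma attach_prob_ge0 E n i : 0 <= attach_prob f E n i.
Proof. by rewrite divr_ge0 ?ltW// weight_gt0. Qed.

Lemma sum_attach_prob E n : \sum_(0 <= i < n.+1) attach_prob f E n i = 1.
Proof. by rewrite -mulr_suml divff// gt_eqF// weight_gt0. Qed.

Lemma sum_attach_prob_pick E n v : (v <= n)%N ->
  \sum_(0 <= i < n.+1) attach_prob f E n i * (i == v)%:R = attach_prob f E n v.
Proof.
move=> vn; rewrite (bigD1_seq v) ?iota_uniq ?mem_index_iota//= eqxx mulr1.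
by rewrite big1 ?addr0// => i /negPf->; rewrite mulr0.
Qed.

(** The mean of [g] after one more edge issued by v_(n+1). Sources are recorded by
    [n], the index of the last vertex that can be hit, rather than by [n.+1]. *)
Definition step n (g : multigraph -> R) E : R :=
  \sum_(0 <= i < n.+1) attach_prob f E n i * g (rcons E (n.+1, i)).

Fixpoint expect ss (g : multigraph -> R) E : R :=
  if ss is n :: ss' then step n (expect ss' g) E else g E.

Lemma ler_step n g h E :
  (forall i, (i <= n)%N -> g (rcons E (n.+1, i)) <= h (rcons E (n.+1, i))) ->
  step n g E <= step n h E.
Proof.
move=> gh; apply: ler_sum_nat => i /andP[_ ni].
by rewrite ler_wpM2l ?attach_prob_ge0 ?gh.
Qed.

Lemma stepD n g h E : step n (fun F => g F + h F) E = step n g E + step n h E.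
Proof.
by rewrite /step -big_split; apply: eq_bigr => i _; rewrite mulrDr.
Qed.

Lemma stepZ n c g E : step n (fun F => c * g F) E = c * step n g E.
Proof. by rewrite /step mulr_sumr; apply: eq_bigr => i _; rewrite mulrCA. Qed.

Lemma step_cst n c E : step n (fun=> c) E = c.
Proof. by rewrite /step -mulr_suml sum_attach_prob mul1r. Qed.

Lemma eq_step n g h E : g =1 h -> step n g E = step n h E.
Proof. by move=> gh; apply: eq_bigr => i _; rewrite gh. Qed.

(** With [a] and [b] the jumps of a quantity when [u] or [v] is hit, the sum of
    the last two terms is the drift of this quantity. *)
Lemma step_linear n E u v a b c : (u <= n)%N -> (v <= n)%N ->
  \sum_(0 <= i < n.+1) attach_prob f E n i *
     (c + a * (i == u)%:R + b * (i == v)%:R) =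
  c + a * attach_prob f E n u + b * attach_prob f E n v.
Proof.
move=> un vn.
rewrite -(sum_attach_prob_pick E un) -(sum_attach_prob_pick E vn).
rewrite -[X in _ = X + _ + _](step_cst n c E) /step.
rewrite !mulr_sumr -!big_split; apply: eq_bigr => i _ /=; ring.
Qed.

Lemma expect_cat s1 s2 g E : expect (s1 ++ s2) g E = expect s1 (expect s2 g) E.
Proof.
elim: s1 E => //= n s1 ih E.
by rewrite /step; apply: eq_bigr => i _; rewrite ih.
Qed.

(** The extensions that have positive probability have the prescribed sources, and
    each of their edges points to an older vertex. *)
Lemma ler_expect_ext ss g h E :
  (forall F, unzip1 F = map succn ss -> all (fun e => e.2 < e.1)%N F ->
     g (E ++ F) <= h (E ++ F)) ->
  expect ss g E <= expect ss h E.
Proof.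
elim: ss E => [|n ss ih] E gh /=; first by have := gh [::]; rewrite cats0; apply.
apply: ler_step => i ni; apply: ih => F Fss F21; rewrite cat_rcons.
by apply: gh => /=; rewrite ?Fss// ltnS ni.
Qed.

Lemma ler_expect ss g h E : (forall F, g F <= h F) ->
  expect ss g E <= expect ss h E.
Proof. by move=> gh; apply: ler_expect_ext. Qed.

Lemma expectD ss g h E :
  expect ss (fun F => g F + h F) E = expect ss g E + expect ss h E.
Proof.
by elim: ss E => //= n ss ih E; rewrite -stepD; apply: eq_step => F; rewrite ih.
Qed.

Lemma expectZ ss c g E : expect ss (fun F => c * g F) E = c * expect ss g E.
Proof.
by elim: ss E => //= n ss ih E; rewrite -stepZ; apply: eq_step => F; rewrite ih.
Qed.

Lemma expect_cst ss c E : expect ss (fun=> c) E = c.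
Proof.
elim: ss E => //= n ss ih E; rewrite -[RHS](step_cst n c E).
by apply: eq_step => F; rewrite ih.
Qed.

(** Doob's maximal inequality. The hypothesis on [ever Q E] says that [Q] does not
    hold strictly before [E], so that the induction stops at the first state where
    [Q] holds; from there on the left-hand side is at most [K]. The supermartingale
    property is only required once [v] can be hit. *)
Lemma supermartingale_maximal v (W : multigraph -> R) (K : R)
    (Q : pred multigraph) ss E :
  (forall F, 0 <= W F) -> 0 <= K -> (forall F, Q F -> K <= W F) ->
  (forall n F, (v <= n)%N -> step n W F <= W F) ->
  all (leq v) ss -> (ever Q E -> Q E) ->
  K * expect ss (fun F => (ever Q F)%:R) E <= W E.
Proof.
move=> W0 K0 QK sW; elim: ss E => [|n ss ih] E /= vss QE.
  have [/QE/QK|_] := boolP (ever Q E); first by rewrite mulr1.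
  by rewrite mulr0.
have [EE|nE] := boolP (ever Q E).
  rewrite (le_trans _ (QK _ (QE EE)))// ler_piMr//.
  rewrite -[leRHS](step_cst n 1 E); apply: ler_step => i _.
  rewrite -[leRHS](expect_cst ss 1 (rcons E (n.+1, i))).
  by apply: ler_expect => F; rewrite lern1; case: (ever Q F).
case/andP: vss => vn vss; apply: le_trans (sW n E vn).
rewrite -stepZ; apply: ler_step => i _; apply: ih => //.
by rewrite ever_rcons (negPf nE).
Qed.

(** The sum, over the edges, of the inverse of the total weight just before the
    attachment: the common compensator of Phi_1 of all the degrees. *)
Definition clock E : R :=
  \sum_(0 <= t < size E) (weight (take t E) (nth (0%N, 0%N) E t).1.-1)^-1.

Lemma clock_rcons E e : clock (rcons E e) = clock E + (weight E e.1.-1)^-1.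
Proof.
rewrite /clock size_rcons big_nat_recr//= -{3}cats1 take_size_cat//.
rewrite nth_rcons ltnn eqxx /=; congr (_ + _); apply: eq_big_nat => t /andP[_ tE].
by rewrite -cats1 takel_cat 1?ltnW// nth_cat tE.
Qed.

Lemma PhiS k l : Phi f k l.+1 = Phi f k l + f l ^- k.
Proof. by rewrite /Phi big_nat_recr. Qed.

Lemma le_Phi k : {homo Phi f k : a b / (a <= b)%N >-> a <= b}.
Proof.
move=> a b /subnKC <-; elim: (b - a)%N => [|c ih]; first by rewrite addn0.
by rewrite addnS PhiS (le_trans ih)// lerDl invr_ge0 exprn_ge0// ltW.
Qed.

Lemma Phi_lt_inv k a b : Phi f k a < Phi f k b -> (a < b)%N.
Proof. by rewrite ltnNge; apply: contraTN => /(le_Phi k); rewrite -leNgt. Qed.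

(** By [expR_ge1Dx], exp(- x + 2 x^2) >= 1 - x + 2 x^2, and
    (1 + x) (1 - x + 2 x^2) = 1 + x^2 (1 + 2 x). The constant 2 makes the bound
    valid down to - 1/2, which negative exponents require. *)
Lemma expR_quadratic_le (x : R) : - 2^-1 <= x -> expR (x - 2 * x ^+ 2) <= 1 + x.
Proof.
move=> x0; rewrite -[x - _]opprK expRN invf_ple ?posrE ?expR_gt0//; last lra.
apply: le_trans (expR_ge1Dx _).
rewrite -[leLHS]mul1r ler_pdivrMr; last lra.
have : 0 <= x ^+ 2 * (1 + 2 * x) by rewrite mulr_ge0 ?sqr_ge0//; lra.
lra.
Qed.

Hypothesis f_ndecr : {homo f : i j / (i <= j)%N >-> i <= j}.

(** The term in Phi_2 compensates the quadratic variation; Phi_2 being bounded, it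
    costs a constant factor only. *)
Definition exp_dev v (l : R) E : R :=
  expR (l * (Phi f 1 (degree E v) - clock E) - 2 * l ^+ 2 * Phi f 2 (degree E v)).

(** A hit multiplies [exp_dev] by exp(x - 2 x^2) <= 1 + x, where x = l / f(degree),
    so its mean is multiplied by at most 1 + l/S <= exp(l/S), which the clock takes
    back. Positive [l] bounds a degree from above, negative [l] from below; in the
    latter case x >= - 1/2 since f is at least f(0). *)
Lemma exp_dev_supermartingale v (l : R) n E :
  - (f 0%N / 2) <= l -> (v <= n)%N ->
  step n (exp_dev v l) E <= exp_dev v l E.
Proof.
move=> l0 vn; set d := degree E v; set S := weight E n.
have fd : 0 < f d by [].
have S0 : 0 < S := weight_gt0 E n.
have x0 : - 2^-1 <= l / f d.
  rewrite ler_pdivlMr// (le_trans _ l0)// mulNr lerN2 mulrC ler_pM2l ?invr_gt0//.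
  exact: f_ndecr.
pose Y := exp_dev v l E * expR (- (l / S)).
apply: le_trans (_ : \sum_(0 <= i < n.+1) attach_prob f E n i *
   (Y + Y * (l / f d) * (i == v)%:R + 0 * (i == v)%:R) <= _).
  apply: ler_sum_nat => i /andP[_ ni]; rewrite ler_wpM2l ?attach_prob_ge0//.
  rewrite mul0r addr0 {1}/exp_dev degree_rcons clock_rcons /= -/S -/d.
  rewrite (_ : n.+1 == v = false) ?addn0; last by apply/eqP; lia.
  have [_|_] := eqVneq i v; last first.
    rewrite mulr0 addr0 addn0 /Y /exp_dev -/d -expRD.
    by rewrite ler_expR le_eqVlt; apply/orP; left; apply/eqP; ring.
  rewrite mulr1 addn1 !PhiS expr1.
  rewrite (_ : Y + Y * (l / f d) = Y * (1 + l / f d)); last by rewrite mulrDr mulr1.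
  apply: le_trans (ler_wpM2l _ (expR_quadratic_le x0)).
    rewrite /Y /exp_dev -/d -!expRD ler_expR le_eqVlt; apply/orP; left; apply/eqP.
    by rewrite exprMn exprVn; ring.
  by rewrite mulr_ge0// expR_ge0.
rewrite step_linear// mul0r addr0 /attach_prob -/d -/(weight E n) -/S.
have -> : Y + Y * (l / f d) * (f d / S) = Y * (1 + l / S).
  by field; rewrite !gt_eqF.
rewrite /Y -mulrA ler_piMr ?expR_ge0//.
apply: le_trans (ler_wpM2l (expR_ge0 _) (expR_ge1Dx _)) _.
by rewrite -expRD addNr expR0.
Qed.
End Walk.

(** * Deviations of a degree from the clock *)

Lemma sorted_split v ss : sorted leq ss ->
  ss = [seq n <- ss | (n < v)%N] ++ [seq n <- ss | (v <= n)%N].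
Proof.
elim: ss => //= n ss ih nss; have := nss => /path_sorted/ih ss_split.
have [nv|vn] := ltnP n v => /=; first by rewrite -ss_split.
have ssv : all (leq v) ss.
  apply/allP => k /(allP (order_path_min leq_trans nss)); exact: leq_trans.
have -> : [seq k <- ss | (k < v)%N] = [::].
  rewrite (@eq_in_filter _ _ pred0) ?filter_pred0// => k /(allP ssv) /= vk.
  by rewrite ltnNge vk.
by move/all_filterP: ssv => ->.
Qed.

(** The number of edges attached when v_v has issued all its edges, i.e. the position
    at which v_v becomes a possible target. *)
Definition birth v (E : multigraph) : nat := count (fun e => (e.1 <= v)%N) E.

Lemma sum_count_eq (h : nat * nat -> nat) (E : multigraph) n :
  (\sum_(0 <= j < n.+1) count (fun e => h e == j) E <= size E)%N.
Proof.
elim: E => [|e E ih] /=; first by rewrite big1.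
rewrite big_split /= -[(size E).+1]add1n leq_add//.
have [he|he] := ltnP (h e) n.+1.
  rewrite (bigD1_seq (h e)) ?iota_uniq ?mem_index_iota//= eqxx big1// => j.
  by rewrite eq_sym => /negPf->.
rewrite big_nat big1// => j /andP[_ jn]; case: eqP => // hj; lia.
Qed.

Lemma sum_degree_le (E : multigraph) n :
  (\sum_(0 <= j < n.+1) degree E j <= 2 * size E)%N.
Proof.
rewrite /degree /indeg /outdeg big_split /= mul2n -addnn.
exact: leq_add (sum_count_eq snd E n) (sum_count_eq fst E n).
Qed.

Section Deviation.
Context {R : realType} (f : nat -> R) (f_gt0 : forall i, 0 < f i).
Context (f_ndecr : {homo f : i j / (i <= j)%N >-> i <= j}).
Implicit Types (E F : multigraph) (ss : seq nat).

Definition drift v (l : R) E : R := l * (Phi f 1 (degree E v) - clock f E).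

(** The threshold [y] may depend on the number of edges at the birth of [v], which is
    the s_n of the theorem. *)
Definition deviates v (l : R) (y : nat -> R) E : bool :=
  let E0 := take (birth v E) E in
  ever (fun F => (size E0 <= size F)%N &&
          (drift v l E0 + y (size E0) <= drift v l F)) E.

Context (P2 : R) (Phi2_le : forall a, Phi f 2 a <= P2).

(** The maximal inequality applied to [exp_dev] from the birth of [v] on, i.e. after
    the sources [s1]; the graph at birth is arbitrary, so it need only be fixed. *)
Lemma expect_deviates_le v (l : R) y s1 s2 : - (f 0%N / 2) <= l ->
  all (fun n => (n < v)%N) s1 -> all (leq v) s2 ->
  expect f (s1 ++ s2) (fun F => (deviates v l y F)%:R) [::]
    <= expR (2 * l ^+ 2 * P2 - y (size s1)).
Proof.
move=> l0 s1v s2v; rewrite expect_cat.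
rewrite -[leRHS](expect_cst f_gt0 s1 _ [::]).
apply: (ler_expect_ext f_gt0) => F Fs1 _ /=.
have sF : size F = size s1 by have := congr1 size Fs1; rewrite !size_map.
pose Q G := (size F <= size G)%N && (drift v l F + y (size F) <= drift v l G).
have bF : birth v F = size F.
  apply/eqP; rewrite -all_count; apply/allP => e eF.
  have : e.1 \in unzip1 F by apply: map_f.
  by rewrite Fs1 => /mapP[n /(allP s1v) nv ->].
have devQ G : unzip1 G = map succn s2 -> deviates v l y (F ++ G) = ever Q (F ++ G).
  move=> Gs2; rewrite /deviates /birth count_cat -/(birth v F) bF.
  rewrite (_ : count _ G = 0%N) ?addn0 ?take_size_cat//.
  apply/eqP; rewrite -leqn0 leqNgt -has_count; apply/hasPn => e eG.
  have : e.1 \in unzip1 G by apply: map_f.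
  by rewrite Gs2 => /mapP[n /(allP s2v) vn ->]; rewrite -ltnNge.
pose K := expR (drift v l F + y (size F) - 2 * l ^+ 2 * P2).
have l2 : 0 <= 2 * l ^+ 2 by rewrite mulr_ge0// sqr_ge0.
apply: le_trans (_ : expect f s2 (fun G => (ever Q G)%:R) F <= _).
  by apply: (ler_expect_ext f_gt0) => G /devQ -> _.
have /(_ F) := @supermartingale_maximal R f f_gt0 v (exp_dev f v l) K Q s2.
have K0 : 0 < K by apply: expR_gt0.
rewrite -ler_pdivlMl//; move=> /(_ _ _ _ _ s2v) maxF.
apply: le_trans (maxF _ _ _ _ _) _.
- by move=> G; apply: expR_ge0.
- exact: ltW.
- move=> G /andP[_ QG]; rewrite /K /exp_dev -/(drift v l G) ler_expR.
  by rewrite lerB// ler_wpM2l.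
- by move=> n G vn; apply: exp_dev_supermartingale.
- move=> /everP[j jF /andP[]]; rewrite size_take_min leq_min leqnn andbT => Fj.
  have -> : j = size F by lia.
  by rewrite take_size /Q leqnn.
rewrite /K /exp_dev -/(drift v l F) -expRN -expRD ler_expR -sF.
have : 0 <= 2 * l ^+ 2 * Phi f 2 (degree F v).
  by rewrite mulr_ge0// (le_trans _ (le_Phi f_gt0 2 (leq0n _)))// /Phi big_nil.
lra.
Qed.

Context (Cf : R) (Cf_gt0 : 0 < Cf) (f_le : forall i, f i <= Cf * i.+1%:R).

Lemma weight_le E n : weight f E n <= Cf * (2 * size E + n.+1)%:R.
Proof.
apply: (@le_trans _ _ (\sum_(0 <= j < n.+1) Cf * (degree E j).+1%:R)).
  exact: ler_sum_nat.
rewrite -mulr_sumr ler_pM2l// -natr_sum ler_nat.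
under eq_bigr do rewrite -addn1.
by rewrite big_split /= sum_nat_const_nat muln1 subn0 leq_add2r sum_degree_le.
Qed.

(** There are at most t + 1 vertices and total degree 2 t after t edges, so the
    total weight is at most Cf (3 t + 1); then sum the inverses. *)
Lemma clock_ge E :
  (forall t, (t < size E)%N -> ((nth (0, 0) E t).1.-1 <= t)%N) ->
  ln (size E).+1%:R / (3 * Cf) <= clock f E.
Proof.
elim/last_ind: E => [_|E e ih slow].
  by rewrite ln1 mul0r /clock big_nil.
rewrite clock_rcons size_rcons; set s := size E.
have es : (e.1.-1 <= s)%N.
  by have := slow s; rewrite size_rcons leqnn nth_rcons ltnn eqxx; apply.
have {}ih : ln s.+1%:R / (3 * Cf) <= clock f E.
  apply: ih => t ts; have := slow t; rewrite size_rcons nth_rcons ts; apply.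
  exact: ltnW.
have w0 := weight_gt0 f_gt0 E e.1.-1.
have ws : (Cf * (3 * s.+1)%:R)^-1 <= (weight f E e.1.-1)^-1.
  rewrite lef_pV2 ?posrE ?mulr_gt0 ?ltr0n//.
  apply: le_trans (weight_le _ _) _; rewrite ler_pM2l// ler_nat; lia.
have s0 : 0 < s.+1%:R :> R by rewrite ltr0n.
have lns : ln s.+2%:R <= ln s.+1%:R + s.+1%:R^-1 :> R.
  rewrite (_ : s.+2%:R = s.+1%:R * (1 + s.+1%:R^-1)); last first.
    by rewrite mulrDr mulr1 divff ?gt_eqF// -natr1.
  have s1 : 0 < s.+1%:R^-1 :> R by rewrite invr_gt0.
  rewrite lnM ?posrE ?addr_gt0// lerD2l le_ln1Dx//.
  by apply: lt_trans s1; rewrite ltrN10.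
apply: le_trans (lerD ih ws).
rewrite (_ : (Cf * _)^-1 = s.+1%:R^-1 / (3 * Cf)); last first.
  by rewrite natrM !invfM; ring.
by rewrite -mulrDl ler_pM2r// invr_gt0 mulr_gt0.
Qed.

End Deviation.

(** * Ties between two vertices *)

Section Ties.
Context {R : realType} (f : nat -> R) (f_gt0 : forall i, 0 < f i).
Context (P2 : R) (Phi2_le : forall a, Phi f 2 a <= P2).
Implicit Types (E F : multigraph) (ss : seq nat) (I : pred nat).

(** With [P2] the sum Phi_2(oo), the quadratic variation still to come for a vertex
    of degree [a]. *)
Definition tail (a : nat) : R := P2 - Phi f 2 a.

Lemma tailS a : tail a.+1 = tail a - f a ^- 2.
Proof. by rewrite /tail PhiS; ring. Qed.

Lemma sqr_jump_le_tail a : f a ^- 2 <= tail a.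
Proof. by have := Phi2_le a.+1; rewrite PhiS /tail; lra. Qed.

Lemma tail_gt0 a : 0 < tail a.
Proof.
by apply: lt_le_trans (sqr_jump_le_tail a); rewrite invr_gt0 exprn_gt0.
Qed.

Lemma le_tail a b : (a <= b)%N -> tail b <= tail a.
Proof. by move=> ab; rewrite lerB// le_Phi. Qed.

(** An edge from a vertex younger than [v] exists. From then on, [v] issues no more
    edges and gains degree only by being hit. *)
Definition born v (E : multigraph) : bool := has (fun e => (v < e.1)%N) E.

Definition tied u v I E : bool :=
  [&& born v E, degree E u == degree E v & I (degree E u)].

Definition urn_gap u v E : R := Phi f 1 (degree E u) - Phi f 1 (degree E v).

Definition urn_tail u v E : R := tail (degree E u) + tail (degree E v).

(** As [M ^+ 2 + V] is a martingale, and [M ^+ 4 + 8 * M ^+ 2 * V + 19 * V ^+ 2] a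
    supermartingale, this is a submartingale. It is at most 1 up to a multiple of [V]
    ([quartic_le]), because 2 x - x^2 <= 1, but it equals 1/19 at a tie for a
    suitable [l]. The coefficients 8 and 19 make the cubic and quartic terms of a
    jump add up to a square and to a multiple of [V - x ^+ 2]. *)
Definition quartic (l M V : R) : R :=
  2 * l * (M ^+ 2 + V) - l ^+ 2 * (M ^+ 4 + 8 * M ^+ 2 * V + 19 * V ^+ 2).

Lemma quartic_jump (l M V x : R) : x ^+ 2 <= V ->
  quartic l M V + (4 * l * M - l ^+ 2 * (4 * M ^+ 3 + 16 * M * V)) * x
    <= quartic l (M + x) (V - x ^+ 2).
Proof.
move=> xV; rewrite -subr_ge0.
rewrite (_ : _ - _ = (l * x) ^+ 2 * (2 * (M + 3 * x) ^+ 2 + 30 * (V - x ^+ 2))).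
  by rewrite mulr_ge0 ?sqr_ge0// addr_ge0// mulr_ge0// ?sqr_ge0// subr_ge0.
rewrite /quartic; ring.
Qed.

Lemma quartic_le (l M V : R) : 0 <= V -> quartic l M V <= 1 + 2 * l * V.
Proof.
move=> V0; rewrite -subr_ge0.
rewrite (_ : _ - _ = (1 - l * M ^+ 2) ^+ 2 +
   l ^+ 2 * (8 * M ^+ 2 * V + 19 * V ^+ 2)); last by rewrite /quartic; ring.
rewrite addr_ge0 ?sqr_ge0// mulr_ge0 ?sqr_ge0//.
have := mulr_ge0 (sqr_ge0 M) V0; have := sqr_ge0 V; lra.
Qed.

(** The terms of [quartic_jump] that are linear in the jump have mean zero: [u] jumps
    by 1/f(a) with probability f(a)/S, [v] by - 1/f(b) with probability f(b)/S. *)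
Lemma quartic_submartingale u v l n E : (u < v)%N -> (v <= n)%N ->
  quartic l (urn_gap u v E) (urn_tail u v E) <=
  step f n (fun F => quartic l (urn_gap u v F) (urn_tail u v F)) E.
Proof.
move=> uv vn; set M := urn_gap u v E; set V := urn_tail u v E.
set psi := 4 * l * M - l ^+ 2 * (4 * M ^+ 3 + 16 * M * V).
set a := degree E u; set b := degree E v.
apply: (@le_trans _ _ (\sum_(0 <= i < n.+1) attach_prob f E n i *
  (quartic l M V + (psi / f a) * (i == u)%:R + (- (psi / f b)) * (i == v)%:R))).
  rewrite step_linear//; last lia.
  rewrite /attach_prob -/a -/b -addrA -[leLHS]addr0 lerD2l.
  rewrite le_eqVlt; apply/orP; left; apply/eqP.
  by field; rewrite ?gt_eqF// (weight_gt0 f_gt0).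
apply: ler_sum_nat => i /andP[_ ni].
rewrite ler_wpM2l ?(attach_prob_ge0 f_gt0)//.
rewrite /urn_gap /urn_tail !degree_rcons -/a -/b.
have -> : (n.+1 == u) = false by apply/eqP; lia.
have -> : (n.+1 == v) = false by apply/eqP; lia.
have ta := sqr_jump_le_tail a; have tb := sqr_jump_le_tail b.
have ta0 := tail_gt0 a; have tb0 := tail_gt0 b.
rewrite !addn0; have [iu|iu] := eqVneq i u.
  have -> : (i == v) = false by apply/eqP; lia.
  rewrite addn0 addn1 mulr1 mulr0 addr0 PhiS tailS expr1.
  have := @quartic_jump l M V (f a)^-1; rewrite exprVn -/psi => H.
  apply: le_trans (H _) _; first by rewrite /V /urn_tail -/a -/b; lra.
  by rewrite le_eqVlt; apply/orP; left; apply/eqP; congr quartic;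
    rewrite /M /V /urn_gap /urn_tail -/a -/b; ring.
have [iv|iv] := eqVneq i v.
  rewrite addn0 addn1 mulr1 mulr0 addr0 PhiS tailS expr1.
  have := @quartic_jump l M V (- (f b)^-1).
  rewrite sqrrN exprVn -/psi mulrN => H.
  apply: le_trans (H _) _; first by rewrite /V /urn_tail -/a -/b; lra.
  by rewrite le_eqVlt; apply/orP; left; apply/eqP; congr quartic;
    rewrite /M /V /urn_gap /urn_tail -/a -/b; ring.
by rewrite !addn0 !mulr0 !addr0 /M /V /urn_gap /urn_tail -/a -/b.
Qed.

Definition low u v N E : bool := ((degree E u < N) || (degree E v < N))%N.

Lemma urn_tail_le u v N E :
  urn_tail u v E <= 2 * tail N + 2 * tail 0 * (low u v N E)%:R.
Proof.
rewrite /urn_tail /low; have tN := tail_gt0 N.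
have := le_tail (leq0n (degree E u)); have := le_tail (leq0n (degree E v)).
case: ltnP => [_|uN] /=; first by rewrite mulr1; lra.
case: ltnP => [_|vN] /=; first by rewrite mulr1; lra.
by rewrite mulr0; have := le_tail uN; have := le_tail vN; lra.
Qed.

(** An upper bound for [quartic] at the first tie at a degree at least [N], or at the
    end of the horizon if there is none: in both cases [urn_tail] is small, unless
    one of the two degrees is still low at the end. *)
Definition escape u v N (l : R) E : R :=
  (~~ ever (tied u v (leq N)) E)%:R
  + 4 * l * (tail N + tail 0 * (low u v N E)%:R).

Lemma quartic_tied (l : R) u v I E : tied u v I E ->
  quartic l (urn_gap u v E) (urn_tail u v E) =
  4 * l * tail (degree E u) - 76 * (l * tail (degree E u)) ^+ 2.
Proof.
case/and3P => _ /eqP uvE _; rewrite /quartic /urn_gap /urn_tail uvE; ring.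
Qed.

(** Optional stopping of the submartingale [quartic] at the first tie at a degree at
    least [N]. *)
Lemma quartic_le_escape u v N (l : R) ss E : 0 <= l -> (u < v)%N ->
  all (leq v) ss -> (ever (tied u v (leq N)) E -> tied u v (leq N) E) ->
  quartic l (urn_gap u v E) (urn_tail u v E) <= expect f ss (escape u v N l) E.
Proof.
move=> l0 uv; have low0 F : 0 <= tail 0 * (low u v N F)%:R.
  by rewrite mulr_ge0 ?ler0n// ltW// tail_gt0.
have at_tie s F : tied u v (leq N) F ->
    quartic l (urn_gap u v F) (urn_tail u v F) <= expect f s (escape u v N l) F.
  move=> TF; rewrite -[leLHS](expect_cst f_gt0 s _ F).
  apply: (ler_expect f_gt0) => G; rewrite (quartic_tied _ TF) /escape.
  case/and3P: TF => _ _ /le_tail tN.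
  have := ler_wpM2l l0 tN; have := mulr_ge0 l0 (low0 G).
  have := sqr_ge0 (l * tail (degree F u)).
  have : 0 <= (~~ ever (tied u v (leq N)) G)%:R :> R by rewrite ler0n.
  lra.
elim: ss E => [|n ss ih] E vss EE;
    have [/EE/at_tie//|nE] := boolP (ever (tied u v (leq N)) E).
  rewrite /= /escape nE.
  have V0 : 0 <= urn_tail u v E by rewrite /urn_tail addr_ge0// ltW// tail_gt0.
  apply: le_trans (quartic_le l (urn_gap u v E) V0) _; rewrite lerD2l.
  have := ler_wpM2l l0 (urn_tail_le u v N E); lra.
case/andP: vss => vn vss; apply: le_trans (quartic_submartingale l E uv vn) _.
apply: (ler_step f_gt0) => i _; apply: ih => //.
by rewrite ever_rcons (negPf nE).
Qed.

(** Each tie at a degree at most [K] is followed, with probability at least 1/19 up to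
    errors, by no tie at all at degrees from [N'] on. The errors vanish when first the
    horizon and then [N'] tend to infinity. Bounding the degree of the first tie by
    [K] keeps [urn_tail] at this tie away from 0. *)
Lemma first_tie_escape u v N K N' ss E : (u < v)%N -> (K < N')%N ->
  sorted leq ss -> (born v E -> all (leq v) ss) ->
  let T1 := tied u v (fun d => (N <= d <= K)%N) in
  let T2 := tied u v (leq N') in
  (ever T1 E -> T1 E) ->
  expect f ss (fun F => (ever T1 F)%:R) E <=
  expect f ss (fun F => 19 * (ever T1 F && ~~ ever T2 F)%:R +
    2 / tail K * (tail N' + tail 0 * (low u v N' F)%:R)) E.
Proof.
move=> uv KN' + + T1 T2; have low0 F : 0 <= tail 0 * (low u v N' F)%:R.
  by rewrite mulr_ge0 ?ler0n// ltW// tail_gt0.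
have at_tie s F : all (leq v) s -> T1 F ->
    expect f s (fun G => (ever T1 G)%:R) F <=
    expect f s (fun G => 19 * (ever T1 G && ~~ ever T2 G)%:R +
      2 / tail K * (tail N' + tail 0 * (low u v N' G)%:R)) F.
  move=> vs TF; set d := degree F u.
  have td0 : 0 < tail d := tail_gt0 d.
  have dK : (d <= K)%N by case/and3P: TF => _ _ /andP[].
  pose l := (38 * tail d)^-1; have l0 : 0 <= l by rewrite invr_ge0 mulr_ge0// ltW.
  have TF2 : ever T2 F -> T2 F.
    move=> /everP[j _ /and3P[_ _ N'j]].
    by have := degree_take_le j F u; rewrite -/d; lia.
  (* With urn_tail equal to 2 * tail d, this l maximizes the value of quartic at a tie. *)
  have := quartic_le_escape l0 uv vs TF2; rewrite (quartic_tied _ TF) -/d.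
  have -> : 4 * l * tail d - 76 * (l * tail d) ^+ 2 = 19^-1.
    by rewrite /l; field; rewrite gt_eqF.
  rewrite -(@ler_pM2l _ 19)// divff ?gt_eqF// -expectZ => le1.
  apply: (@le_trans _ _ 1).
    rewrite -[leRHS](expect_cst f_gt0 s 1 F); apply: (ler_expect f_gt0) => G.
    by rewrite lern1; case: (ever T1 G).
  apply: le_trans le1 _; apply: (ler_expect_ext f_gt0) => G _ _.
  rewrite (ever_cat G (ever_now TF)) /= /escape mulrDr lerD2l.
  have -> : 19 * (4 * l * (tail N' + tail 0 * (low u v N' (F ++ G))%:R)) =
     2 / tail d * (tail N' + tail 0 * (low u v N' (F ++ G))%:R).
    by rewrite /l; field; rewrite gt_eqF.
  have tN' := ltW (tail_gt0 N'); apply: ler_wpM2r; first exact: addr_ge0.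
  rewrite ler_pM2l//.
  by rewrite lef_pV2 ?posrE ?tail_gt0// le_tail.
elim: ss E => [|n ss ih] E sss vss T1E;
    have [ET|nE] := boolP (ever T1 E); try exact: at_tie (vss _) (T1E ET).
- by apply: at_tie => //; apply: T1E.
- rewrite /= (negPf nE) /= mulr0 add0r; have tN' := ltW (tail_gt0 N').
  apply: mulr_ge0; last exact: addr_ge0.
  by rewrite divr_ge0// ltW// tail_gt0.
- apply: at_tie; last exact: T1E.
  by apply: vss; case/and3P: (T1E ET).
- apply: (ler_step f_gt0) => i _; apply: ih.
  + exact: path_sorted sss.
  + rewrite /born has_rcons /= => /orP[vn|/vss/andP[]//].
    apply/allP => k /(allP (order_path_min leq_trans sss)); apply: leq_trans.
    by rewrite -ltnS.
  + by rewrite ever_rcons (negPf nE).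
Qed.
End Ties.

(** * Maps with countably many values and limits of probabilities *)

Section CountableValued.
Context {d : measure_display} {T : measurableType d}.

(** Measurability for the discrete sigma-algebra on the codomain. *)
Definition preimage_measurable {A : countType} (h : T -> A) : Prop :=
  forall S : set A, measurable (h @^-1` S).

Lemma preimage_measurable_fibers {A : countType} (h : T -> A) :
  (forall a, measurable (h @^-1` [set a])) -> preimage_measurable h.
Proof.
move=> mh S; rewrite (_ : _ @^-1` _ = \bigcup_k
    (if unpickle k is Some a then h @^-1` ([set a] `&` S) else set0)).
  apply: bigcupT_measurable => k; case: unpickle => [a|//].
  have [Sa|nSa] := pselect (S a).
    rewrite (_ : [set a] `&` S = [set a])//.
    by apply/seteqP; split => [x []//|x ->].
  rewrite (_ : h @^-1` _ = set0)//.
  by rewrite -subset0 => w /= [->].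
apply/seteqP; split => [w Sw|w [k _]] /=.
  by exists (pickle (h w)) => //; rewrite pickleK.
by case: unpickle => [a [_]|].
Qed.

(** This covers the number of edges of a vertex, which is random. *)
Lemma preimage_measurable_bind {A B : countType} (q : T -> A) (h : A -> T -> B) :
  preimage_measurable q -> (forall a, preimage_measurable (h a)) ->
  preimage_measurable (fun w => h (q w) w).
Proof.
move=> mq mh S; rewrite (_ : _ @^-1` _ = \bigcup_k
    (if unpickle k is Some a then q @^-1` [set a] `&` h a @^-1` S else set0)).
  apply: bigcupT_measurable => k; case: unpickle => [a|//].
  by apply: measurableI; [exact: mq|exact: mh].
apply/seteqP; split => [w Sw|w [k _]] /=.
  by exists (pickle (q w)) => //; rewrite pickleK.
by case: unpickle => // a [<-].
Qed.

Lemma preimage_measurable_comp {A B : countType} (q : T -> A) (h : A -> B) :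
  preimage_measurable q -> preimage_measurable (h \o q).
Proof. by move=> mq S; exact: (mq (h @^-1` S)). Qed.

Lemma preimage_measurable_cst {A : countType} (a : A) :
  preimage_measurable (fun _ : T => a).
Proof. by move=> S; rewrite preimage_cst; case: ifP. Qed.

Lemma measurable_pred {A : countType} (h : T -> A) (B : pred A) :
  preimage_measurable h -> measurable [set w | B (h w)].
Proof. by move=> /(_ [set a | B a]). Qed.

End CountableValued.

Section ProbabilityLimits.
Context {d : measure_display} {T : measurableType d} {R : realType}.

Lemma EFin_fine_probability {P : probability T R} (A : set T) :
  measurable A -> (fine (P A))%:E = P A.
Proof. by move=> mA; rewrite fineK// fin_num_measure. Qed.

Lemma le_probability {P : probability T R} (A B : set T) :
  measurable A -> measurable B -> A `<=` B -> (P A <= P B)%E.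
Proof. by move=> mA mB; apply: le_measure; rewrite inE. Qed.

Context (P : probability T R).

Lemma le_probability_bigcup (F : (set T)^nat) (c : \bar R) :
  (forall i, measurable (F i)) -> {homo F : i j / (i <= j)%N >-> i `<=` j} ->
  (forall i, (P (F i) <= c)%E) -> (P (\bigcup_i F i) <= c)%E.
Proof.
move=> mF ndF Fc; have /cvg_lim <- // : P \o F @ \oo --> P (\bigcup_i F i).
  apply: nondecreasing_cvg_mu => //; first exact: bigcupT_measurable.
  by move=> i j ij; apply/subsetPset; exact: ndF.
apply: lime_le; last exact: nearW.
apply: ereal_nondecreasing_is_cvgn => i j ij /=.
by apply: le_probability => //; exact: ndF.
Qed.

Lemma probability_bigcup_near (F : (set T)^nat) (e : R) : 0 < e ->
  (forall i, measurable (F i)) -> {homo F : i j / (i <= j)%N >-> i `<=` j} ->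
  exists n0, forall n, (n0 <= n)%N ->
    fine (P (\bigcup_i F i)) < fine (P (F n)) + e.
Proof.
move=> e0 mF ndF; apply: contrapT => nF.
have mU : measurable (\bigcup_i F i) by exact: bigcupT_measurable.
suff : (P (\bigcup_i F i) <= (fine (P (\bigcup_i F i)) - e)%:E)%E.
  by rewrite -(EFin_fine_probability mU) lee_fin; lra.
apply: le_probability_bigcup => // i.
rewrite -(EFin_fine_probability (mF i)) lee_fin leNgt; apply/negP => iF.
apply: nF; exists i => n iN; rewrite -ltrBlDr (lt_le_trans iF)//.
rewrite fine_le ?fin_num_measure//; apply: le_probability => //; exact: ndF.
Qed.

Lemma probability_bigcap_near (F : (set T)^nat) (e : R) : 0 < e ->
  (forall i, measurable (F i)) -> {homo F : i j / (i <= j)%N >-> j `<=` i} ->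
  exists n0, forall n, (n0 <= n)%N ->
    fine (P (F n)) < fine (P (\bigcap_i F i)) + e.
Proof.
move=> e0 mF niF.
have mC i : measurable (~` F i) by exact: measurableC.
have [|n0 near0] := @probability_bigcup_near (fun i => ~` F i) e e0 mC.
  by move=> i j /niF; exact: subsetC.
exists n0 => n /near0; rewrite -setC_bigcap !probability_setC//; last first.
  exact: bigcapT_measurable.
rewrite -(EFin_fine_probability (mF n)).
rewrite -(EFin_fine_probability (bigcapT_measurable mF)) -!EFinB /=; lra.
Qed.

(** Exponential bounds at all integer levels, as needed for the supremum of a
    process to be almost surely finite. *)
Lemma probability0_of_le (A : set T) (C : R) : measurable A ->
  (forall y : nat, (P A <= (expR (C - y%:R))%:E)%E) -> P A = 0%E.
Proof.
move=> mA Ale; rewrite -(EFin_fine_probability mA); congr EFin.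
set x := fine (P A); have x0 : 0 <= x by exact: fine_ge0.
apply/eqP; rewrite eq_le x0 andbT leNgt; apply/negP => xgt0.
pose y := Num.bound (expR C / x).
have := Ale y; rewrite -(EFin_fine_probability mA) lee_fin -/x leNgt.
rewrite expRB ltr_pdivrMr ?expR_gt0// mulrC -ltr_pdivrMr// => /negP; apply.
apply: lt_le_trans (_ : 1 + y%:R <= _); last exact: expR_ge1Dx.
apply: lt_trans (_ : y%:R < _); last by rewrite ltrDr.
by apply: archi_boundP; rewrite divr_ge0// expR_ge0.
Qed.

End ProbabilityLimits.

(** * The edges of the random graph in the order of attachment *)

Section GraphPaths.
Context {d : measure_display} {T : measurableType d} {R : realType}.
Context {P : probability T R}.
Variables (m : nat -> {RV P >-> nat}) (X : nat -> nat -> {RV P >-> nat}).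
Let G := graph m X.

(** A function of the m_i alone: the source v_(n+1) is recorded by [n], as in [step]. *)
Fixpoint sources (n : nat) (w : T) : seq nat :=
  if n is n'.+1 then sources n' w ++ nseq (m n'.+1 w) n' else [::].

Lemma unzip1_graph n w : unzip1 (G n w) = map succn (sources n w).
Proof.
elim: n => //= n ih; rewrite /unzip1 !map_cat -/(unzip1 _) ih; congr (_ ++ _).
rewrite map_nseq -map_comp.
by apply: (@eq_from_nth _ 0%N) => [|i];
  rewrite ?size_map ?size_iota ?size_nseq// => ik;
  rewrite (nth_map 0%N) ?size_iota// nth_nseq ik.
Qed.

Lemma size_graph n w : size (G n w) = size (sources n w).
Proof. by have := congr1 size (unzip1_graph n w); rewrite !size_map. Qed.

Lemma sources_lt n w k : k \in sources n w -> (k < n)%N.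
Proof.
elim: n => //= n ih; rewrite mem_cat mem_nseq => /orP[/ih|/andP[_ /eqP->]//].
exact: ltnW.
Qed.

Lemma sources_sorted n w : sorted leq (sources n w).
Proof.
elim: n => //= n ih; rewrite sorted_pairwise; last exact: leq_trans.
rewrite pairwise_cat -!sorted_pairwise; try exact: leq_trans.
rewrite ih /=; apply/andP; split.
  apply/allrelP => a b /sources_lt an; rewrite mem_nseq => /andP[_ /eqP->].
  exact: ltnW.
by case: (m _ w) => //= k; elim: k => //= k ->; rewrite leqnn.
Qed.

Lemma graph_prefix n N w : (n <= N)%N ->
  exists2 F, G N w = G n w ++ F & all (fun e => n < e.1)%N F.
Proof.
move=> /subnKC <-; elim: (N - n)%N => [|k [F ih nF]].
  by exists [::] => //; rewrite addn0 cats0.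
rewrite addnS /= ih -catA; eexists; first by [].
by rewrite all_cat nF; apply/allP => _ /mapP[j _ ->] /=; rewrite ltnS leq_addr.
Qed.

Lemma sources_prefix n N w : (n <= N)%N ->
  exists2 F, sources N w = sources n w ++ F & all (leq n) F.
Proof.
move=> /subnKC <-; elim: (N - n)%N => [|k [F ih nF]].
  by exists [::] => //; rewrite addn0 cats0.
rewrite addnS /= ih -catA; eexists; first by [].
rewrite all_cat nF /=; apply/allP => j; rewrite mem_nseq => /andP[_ /eqP->].
exact: leq_addr.
Qed.

Lemma count_sources n N w : (n <= N)%N ->
  count (fun j => (j < n)%N) (sources N w) = size (G n w).
Proof.
move=> nN; have [F -> nF] := sources_prefix w nN.
rewrite count_cat size_graph (_ : count _ F = 0%N) ?addn0.
  by apply/eqP; rewrite -all_count; apply/allP => j /sources_lt.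
apply/eqP; rewrite -leqn0 leqNgt -has_count; apply/hasPn => j /(allP nF) /= nj.
by rewrite -leqNgt.
Qed.

(** Locates the edge number [t] in the model: it is the edge number [k] of
    v_(n+1). *)
Lemma graph_step N t w : (t < size (sources N w))%N ->
  let n := nth 0%N (sources N w) t in let k := (t - size (G n w))%N in
  [/\ (n < N)%N, (size (G n w) <= t)%N, (k < m n.+1 w)%N,
      take t (G N w) = partial_graph m X n k w &
      take t.+1 (G N w) = rcons (partial_graph m X n k w) (n.+1, X n.+1 k w)].
Proof.
elim: N => //= N ih; rewrite size_cat size_nseq => tN.
have [tN'|Nt] := ltnP t (size (sources N w)).
  have [] := ih tN'; rewrite nth_cat tN' => nN nt kn take_t take_tS.
  split=> //; first exact: ltnW.
  - by rewrite takel_cat// size_graph ltnW.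
  - by rewrite takel_cat ?take_tS // size_graph.
have -> : nth 0%N (sources N w ++ nseq (m N.+1 w) N) t = N.
  by rewrite nth_cat ltnNge Nt /= nth_nseq ifT//; lia.
rewrite size_graph; set k := (t - _)%N; have kN : (k < m N.+1 w)%N by lia.
have take_k j : (j <= m N.+1 w)%N ->
    take (size (sources N w) + j) (G N w ++
      [seq (N.+1, X N.+1 k w) | k <- iota 0 (m N.+1 w)]) =
    partial_graph m X N j w.
  move=> jm; rewrite /partial_graph take_cat size_graph ltnNge leq_addr /=.
  by rewrite addKn -map_take take_iota (minn_idPl jm).
split=> //.
  by rewrite -(take_k k (ltnW kN)) /k subnKC.
have -> : t.+1 = (size (sources N w) + k.+1)%N by rewrite /k; lia.
rewrite take_k//.
by rewrite /partial_graph -(addn1 k) iotaD add0n map_cat /= cats1 -rcons_cat.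
Qed.

End GraphPaths.

(** * From finite expectations to the model *)

Section Transfer.
Context {d : measure_display} {T : measurableType d} {R : realType}.
Context {P : probability T R}.
Variables (m : nat -> {RV P >-> nat}) (X : nat -> nat -> {RV P >-> nat}).
Context (f : nat -> R) (f_gt0 : forall i, 0 < f i).
Let G := graph m X.

Lemma preimage_measurable_RV (Y : {RV P >-> nat}) :
  preimage_measurable (Y : T -> nat).
Proof.
move=> S; rewrite -[_ @^-1` _]setTI.
by apply: (measurable_funP Y).
Qed.

Lemma preimage_measurable_edges a k :
  preimage_measurable (fun w => [seq (a, X a l w) | l <- iota 0 k]).
Proof.
elim: k => [|k ih]; first exact: preimage_measurable_cst.
rewrite (_ : (fun w => _) = (fun w => (fun E => rcons E (a, X a k w))
    [seq (a, X a l w) | l <- iota 0 k])); last first.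
  by apply/funext => w; rewrite -addn1 iotaD map_cat cats1.
apply: (preimage_measurable_bind (h := fun E w => rcons E (a, X a k w))) => // E.
apply: (preimage_measurable_comp (fun i => rcons E (a, i))).
exact: preimage_measurable_RV.
Qed.

Lemma preimage_measurable_graph n : preimage_measurable (G n).
Proof.
elim: n => [|n ih]; first exact: preimage_measurable_cst.
apply: (preimage_measurable_bind (h := fun E w =>
  E ++ [seq (n.+1, X n.+1 k w) | k <- iota 0 (m n.+1 w)])) => // E.
apply: (preimage_measurable_bind (h := fun j w =>
  E ++ [seq (n.+1, X n.+1 k w) | k <- iota 0 j])).
  exact: preimage_measurable_RV.
move=> j; apply: (preimage_measurable_comp (cat E)).
exact: preimage_measurable_edges.
Qed.

Definition history_events n k : set (set T) :=
  [set A | (exists i b, (0 < i)%N /\ A = m i @^-1` [set b]) \/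
           (exists E, A = partial_graph m X n k @^-1` [set E])].

(** The history contains the whole sequence of the m_i, so even the sources of
    edges not yet attached are known. *)
Lemma history_sources n k N :
  preimage_measurable (T := g_sigma_algebraType (history_events n k))
    (sources m N : g_sigma_algebraType (history_events n k) -> seq nat).
Proof.
elim: N => [|N ih]; first exact: preimage_measurable_cst.
pose h ss (w : g_sigma_algebraType (history_events n k)) :=
  ss ++ nseq (m N.+1 w) N.
apply: (preimage_measurable_bind (h := h) ih) => ss.
apply: (preimage_measurable_comp (fun j => ss ++ nseq j N)).
apply: preimage_measurable_fibers => b; apply: sub_sigma_algebra.
by left; exists N.+1, b.
Qed.

Lemma history_atom n k N ss E :
  history m X n k [set w | sources m N w = ss /\ partial_graph m X n k w = E].
Proof.
have mss := @history_sources n k N [set ss].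
have mE : measurable ((fun w => partial_graph m X n k w = E) :
    set (g_sigma_algebraType (history_events n k))).
  by apply: sub_sigma_algebra; right; exists E.
exact: measurableI mss mE.
Qed.

(** The whole sequence of sources and the first [t] edges are given. *)
Let atom N ss t E : set T :=
  [set w | sources m N w = ss /\ take t (G N w) = E].

Lemma measurable_atom N ss t E : measurable (atom N ss t E).
Proof.
have mG := preimage_measurable_graph N.
rewrite (_ : atom _ _ _ _ = G N @^-1` [set F |
   map succn ss = unzip1 F /\ take t F = E]); first exact: mG.
apply/seteqP; split => w [sw tw]; split => //.
  by rewrite unzip1_graph sw.
by move: sw; rewrite unzip1_graph => /(inj_map succn_inj).
Qed.

Hypothesis hX : preferential_attachment m X f.

(** The transition probabilities of the model on an event where the sources are
    fixed: such an event belongs to the history, and the conditional probability is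
    constant on it. *)
Lemma atom_step N ss t E i : (t < size ss)%N ->
  let n := nth 0%N ss t in (i <= n)%N ->
  P (atom N ss t.+1 (rcons E (n.+1, i))) =
  ((attach_prob f E n i)%:E * P (atom N ss t E))%E.
Proof.
move=> tss n ni; pose k := (t - count (fun j => (j < n)%N) ss)%N.
have stepE w : sources m N w = ss -> [/\ (k < m n.+1 w)%N,
    take t (G N w) = partial_graph m X n k w &
    take t.+1 (G N w) = rcons (partial_graph m X n k w) (n.+1, X n.+1 k w)].
  move=> sw; have := @graph_step _ _ _ _ m X N t w; rewrite sw -/n => /(_ tss).
  move=> [nN _]; rewrite -(count_sources _ _ _ (ltnW nN)) sw -/k.
  by move=> *; split.
have -> : atom N ss t E =
    [set w | sources m N w = ss /\ partial_graph m X n k w = E].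
  by apply/seteqP; split => w /= [sw]; rewrite /atom /=; have [_ -> _] := stepE w sw.
have [_ /(_ _ (@history_atom n k N ss E))] := hX k ni.
rewrite (_ : _ `&` _ = atom N ss t.+1 (rcons E (n.+1, i))); last first.
  rewrite /atom; apply/seteqP; split => w /=.
    by move=> [[_ Xi] [sw pE]]; split => //; have [_ _ ->] := stepE w sw; rewrite Xi pE.
  move=> [sw]; have [km _ ->] := stepE w sw => /rcons_inj[pE Xi].
  by split.
move=> ->; rewrite -integral_cst; last first.
  have := measurable_atom N ss t E; rewrite (_ : atom N ss t E =
    [set w | sources m N w = ss /\ partial_graph m X n k w = E])//.
  by apply/seteqP; split => w /= [sw]; rewrite /atom /=; have [_ -> _] := stepE w sw.
apply: eq_integral => w; rewrite inE => -[sw pE].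
by have [-> _ _] := stepE w sw; rewrite pE.
Qed.

Let graph_in N (B : pred multigraph) : set T := [set w | B (G N w)].

Lemma measurable_graph_in N B : measurable (graph_in N B).
Proof. exact: measurable_pred (preimage_measurable_graph N). Qed.

(** Backward induction on the edges to come. The targets beyond [n] are excluded
    because the transition probabilities add up to 1. *)
Lemma atom_expect_le N ss (B : pred multigraph) rest t E :
  drop t ss = rest ->
  (P (atom N ss t E `&` graph_in N B) <=
     (expect f rest (fun F => (B F)%:R) E)%:E * P (atom N ss t E))%E.
Proof.
elim: rest t E => [|n rest ih] t E drop_t /=.
  have sst : (size ss <= t)%N by rewrite -subn_eq0 -size_drop drop_t.
  have atomE w : atom N ss t E w -> G N w = E.
    by move=> [sw <-]; rewrite take_oversize// size_graph sw.
  have [BE|nBE] := boolP (B E).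
    rewrite mulr1n mul1e; apply: le_probability; [|exact: measurable_atom|exact: subIsetl].
    by apply: measurableI; [exact: measurable_atom|exact: measurable_graph_in].
  rewrite (_ : _ `&` _ = set0) ?measure0 ?mulr0n ?mul0e//.
  by rewrite -subset0 => w [/atomE GE]; rewrite /graph_in /= GE (negPf nBE).
have tss : (t < size ss)%N.
  by rewrite ltnNge; apply/negP => /drop_oversize; rewrite drop_t.
have [nt restE] : n = nth 0%N ss t /\ drop t.+1 ss = rest.
  by move: drop_t; rewrite (drop_nth 0%N tss) => -[].
pose A i := atom N ss t.+1 (rcons E (n.+1, i)).
have mA i : measurable (A i) by apply: measurable_atom.
have mD : measurable (atom N ss t E) := measurable_atom N ss t E.
have mB := measurable_graph_in N B.
pose p i := attach_prob f E n i.
have PA i : (i <= n)%N -> P (A i) = ((p i)%:E * P (atom N ss t E))%E.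
  by move=> ni; rewrite /p /A nt; apply: atom_step; rewrite -?nt.
have AD i : A i `<=` atom N ss t E.
  move=> w [sw]; rewrite (take_nth (0, 0)) ?size_graph ?sw// => /rcons_inj[].
  by split.
have trA : trivIset setT A.
  apply/trivIsetP => i j _ _ ij; rewrite -subset0 => w [[_ Ai] [_]].
  by rewrite Ai => /rcons_inj[/eqP]; rewrite (negPf ij).
(* U is the event that the next target is one of the admissible vertices. *)
pose U := \big[setU/set0]_(i < n.+1) A i.
have mU : measurable U by apply: bigsetU_measurable.
have UD : U `<=` atom N ss t E by rewrite /U -bigcup_mkord => w [i _ /AD].
have PU : P U = P (atom N ss t E).
  rewrite /U measure_bigsetU//.
  transitivity (\sum_(i < n.+1) (p i)%:E * P (atom N ss t E))%E.
    by apply: eq_bigr => i _; apply: PA; rewrite -ltnS.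
  rewrite -(EFin_fine_probability mD).
  under eq_bigr do rewrite -EFinM.
  by rewrite sumEFin -mulr_suml -(big_mkord xpredT) (sum_attach_prob f_gt0) mul1r.
have PDU : P (atom N ss t E `\` U) = 0%E.
  have : (P (atom N ss t E) = P (atom N ss t E `\` U) + P (atom N ss t E `&` U))%E.
    exact: measureDI.
  have mDU := measurableD mD mU.
  rewrite setIC (setIidl UD) PU -(EFin_fine_probability mD).
  by rewrite -(EFin_fine_probability mDU) -EFinD => -[] pE; congr EFin; lra.
rewrite (@measureDI _ _ _ P _ U)//; last exact: measurableI.
rewrite (subset_measure0 _ _ _ PDU) ?add0e//; first last.
- by move=> w [[]].
- exact: measurableD.
- by apply: measurableD => //; exact: measurableI.
apply: (@le_trans _ _ (\sum_(i < n.+1) P (A i `&` graph_in N B))%E).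
  have := @content_subadditive _ _ _ P (atom N ss t E `&` graph_in N B `&` U)
    (fun i => A i `&` graph_in N B) n.+1; apply.
  - by move=> i _; exact: measurableI.
  - by apply: measurableI => //; exact: measurableI.
  - rewrite /U -bigcup_mkord -(bigcup_mkord _ (fun i => A i `&` graph_in N B)).
    move=> w [[Dw Bw] [i /= ni Aw]].
    by exists i.
apply: le_trans (lee_sum _ (fun i _ => ih t.+1 _ restE)) _.
rewrite -(EFin_fine_probability mD) -EFinM /step big_mkord mulr_suml -sumEFin.
apply: lee_sum => i _; rewrite -/(A i) PA -1?ltnS//.
by rewrite -(EFin_fine_probability mD) -!EFinM lee_fin mulrCA mulrA.
Qed.

(** The reverse inequality follows by complementation. *)
Lemma atom_expect N ss (B : pred multigraph) :
  P ([set w | sources m N w = ss] `&` graph_in N B) =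
  ((expect f ss (fun F => (B F)%:R) [::])%:E * P [set w | sources m N w = ss])%E.
Proof.
have atom0 : [set w | sources m N w = ss] = atom N ss 0 [::].
  by apply/seteqP; split => w /=; [move=> sw; split; rewrite ?take0|case].
have mC := measurable_atom N ss 0 [::]; rewrite atom0.
have mB := measurable_graph_in N B.
have le1 := atom_expect_le N B [::] (drop0 ss).
have le2 := atom_expect_le N (predC B) [::] (drop0 ss).
set C := atom N ss 0 [::] in le1 le2 mC *.
apply/eqP; rewrite eq_le; apply/andP; split; first exact: le1.
have PC : P C = (P (C `&` graph_in N (predC B)) + P (C `&` graph_in N B))%E.
  rewrite (@measureDI _ _ _ P _ _ mC mB); congr (P _ + _)%E.
  by apply/seteqP; split => w [Cw /negP].
have eC : expect f ss (fun F => (predC B F)%:R) [::] =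
    1 - expect f ss (fun F => (B F)%:R) [::].
  rewrite -[X in X - _](expect_cst f_gt0 ss 1 [::]) -mulN1r -expectZ -expectD.
  congr expect; apply/funext => F /=; by case: (B F) => /=; ring.
move: le2 PC; rewrite eC.
have mCB := measurableI _ _ mC mB.
have mCB' := measurableI _ _ mC (measurable_graph_in N (predC B)).
rewrite -(EFin_fine_probability mC) -(EFin_fine_probability mCB).
rewrite -(EFin_fine_probability mCB') -!EFinM -EFinD !lee_fin => + [].
lra.
Qed.

Let sources_code N k : set T := [set w | pickle (sources m N w) = k].

Lemma measurable_sources_code N k : measurable (sources_code N k).
Proof.
have mG := preimage_measurable_graph N.
rewrite (_ : sources_code N k =
  G N @^-1` [set E | pickle (map predn (unzip1 E)) = k]); first exact: mG.
by apply/seteqP; split => w; rewrite /sources_code /= unzip1_graph mapK.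
Qed.

Lemma probability_sources N (D : set T) : measurable D ->
  P D = (\sum_(0 <= k <oo) P (D `&` sources_code N k))%E.
Proof.
move=> mD; have mS := measurable_sources_code N.
rewrite -measure_semi_bigcup.
- rewrite -setI_bigcupr (_ : \bigcup_k _ = setT) ?setIT//.
  by apply/seteqP; split => // w _; exists (pickle (sources m N w)).
- by move=> k; exact: measurableI.
- by apply/trivIsetP => i j _ _ ij; rewrite -subset0 => w [[_ iw] [_ jw]];
    move: ij; rewrite -iw -jw eqxx.
- by apply: bigcupT_measurable => k; exact: measurableI.
Qed.

(** The form in which estimates on [expect] that hold for every sequence of sources
    are used: sum them over the countably many sequences. *)
Lemma probability_graph_le N (B1 B2 B3 : pred multigraph) (a2 a3 a4 : R) :
  0 <= a2 -> 0 <= a3 -> 0 <= a4 ->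
  (forall w, let prob (B : pred multigraph) :=
       expect f (sources m N w) (fun F => (B F)%:R) [::] in
     prob B1 <= a2 * prob B2 + a3 * prob B3 + a4) ->
  (P (graph_in N B1) <=
     a2%:E * P (graph_in N B2) + a3%:E * P (graph_in N B3) + a4%:E)%E.
Proof.
move=> a20 a30 a40 Ble; have mB := measurable_graph_in N.
rewrite !(@probability_sources N (graph_in _ _))//.
rewrite -[X in (_ <= _ + X)%E]mule1 -(@probability_setT _ _ _ P).
rewrite (@probability_sources N setT)//.
have mS := measurable_sources_code N.
have ge0 D a : 0 <= a -> forall k, (0 <= a%:E * P (D `&` sources_code N k))%E.
  by move=> a0 k; rewrite mule_ge0.
rewrite -!nneseriesZl; [|by []|by []|by []].
rewrite -nneseriesD; [|by move=> k _ _; exact: ge0|by move=> k _ _; exact: ge0].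
rewrite -nneseriesD; [|by move=> k _ _; rewrite adde_ge0// ge0
  |by move=> k _ _; exact: ge0].
apply: lee_nneseries => // k _.
have [[w0 w0k]|nk] := pselect (exists w, sources_code N k w); last first.
  rewrite (_ : sources_code N k = set0) ?setI0 ?measure0 ?mule0 ?adde0//.
  by rewrite -subset0 => w wk; apply: nk; exists w.
have -> : sources_code N k = [set w | sources m N w = sources m N w0].
  apply/seteqP; split => w; rewrite /sources_code /= -w0k; last by move=> ->.
  exact: (pcan_inj pickleK).
have mC : measurable [set w | sources m N w = sources m N w0].
  have := mS (pickle (sources m N w0)).
  rewrite (_ : sources_code _ _ = [set w | sources m N w = sources m N w0])//.
  apply/seteqP; split => w; rewrite /sources_code /=; last by move=> ->.
  exact: (pcan_inj pickleK).
rewrite setTI ![graph_in _ _ `&` _]setIC !atom_expect.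
rewrite -(EFin_fine_probability mC) -!EFinM -!EFinD lee_fin !mulrA -!mulrDl.
apply: ler_wpM2r; [exact: fine_ge0|exact: Ble].
Qed.
End Transfer.

(** * Almost sure growth of the degrees *)

Lemma sum_expR_ln_le {R : realType} n :
  \sum_(0 <= v < n) expR (- (2 * ln v%:R)) <= 3 :> R.
Proof.
have sq k : expR (- (2 * ln k.+1%:R)) = (k.+1%:R ^+ 2)^-1 :> R.
  by rewrite expRN expRM_natl lnK// posrE.
have e0 k : 0 <= expR (- (2 * ln k%:R)) :> R by apply: expR_ge0.
suff H k : \sum_(0 <= v < k.+2) expR (- (2 * ln v%:R)) <= 3 - k.+1%:R^-1 :> R.
  apply: le_trans (_ : \sum_(0 <= v < n.+2) expR (- (2 * ln v%:R)) <= _).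
    by rewrite !big_nat_recr//= -addrA lerDl addr_ge0.
  by apply: le_trans (H n) _; rewrite gerBl invr_ge0.
elim: k => [|k ih].
  by rewrite !big_nat_recr//= big_nil sq ln0// mulr0 oppr0 expR0; lra.
rewrite big_nat_recr//= sq; apply: le_trans (lerD ih (lexx _)) _.
have a0 : 0 < k.+1%:R :> R by rewrite ltr0n.
have b0 : 0 < k.+2%:R :> R by rewrite ltr0n.
rewrite -addrA lerD2l -subr_ge0.
have -> : - k.+2%:R^-1 - (- k.+1%:R^-1 + (k.+2%:R ^+ 2)^-1) =
    (k.+1%:R * k.+2%:R ^+ 2)^-1 :> R.
  have -> : k.+2%:R = k.+1%:R + 1 :> R by rewrite natr1.
  by field; rewrite !gt_eqF// addr_gt0.
by rewrite invr_ge0 mulr_ge0// exprn_ge0.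
Qed.

Section DegreeDeviations.
Context {d : measure_display} {T : measurableType d} {R : realType}.
Context {P : probability T R}.
Variables (m : nat -> {RV P >-> nat}) (X : nat -> nat -> {RV P >-> nat}).
Context (f : nat -> R) (f_gt0 : forall i, 0 < f i).
Context (f_ndecr : {homo f : i j / (i <= j)%N >-> i <= j}).
Context (P2 : R) (Phi2_le : forall a, Phi f 2 a <= P2).
Context (m_gt0 : forall i w, (0 < i)%N -> (0 < m i w)%N).
Hypothesis hX : preferential_attachment m X f.
Let G := graph m X.

Lemma leq_size_graph n w : (n <= size (G n w))%N.
Proof.
elim: n => //= n ih; rewrite size_cat size_map size_iota.
by have := m_gt0 w (ltn0Sn n); lia.
Qed.

Lemma birth_graph v N w : (v <= N)%N -> birth v (G N w) = size (G v w).
Proof.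
move=> vN; rewrite -(count_sources m X w vN).
rewrite /birth -(count_map fst (fun a => (a <= v)%N)) -/(unzip1 _) unzip1_graph.
by rewrite count_map.
Qed.

Lemma take_graph v N w : (v <= N)%N -> take (size (G v w)) (G N w) = G v w.
Proof.
by move=> vN; have [F GF _] := graph_prefix m X w vN; rewrite /G GF take_size_cat.
Qed.

Definition deviates_from v (l : R) (y : nat -> R) (E0 : multigraph) :=
  ever (fun F => (size E0 <= size F)%N &&
          (drift f v l E0 + y (size E0) <= drift f v l F)).

Lemma deviates_graph v l y N w : (v <= N)%N ->
  deviates f v l y (G N w) = deviates_from v l y (G v w) (G N w).
Proof. by move=> vN; rewrite /deviates birth_graph// take_graph. Qed.

(** The bounds for finite horizons pass to the limit since the events increase. *)
Lemma probability_deviates v (l : R) (y : nat -> R) (y0 : R) :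
  - (f 0%N / 2) <= l -> (forall s, (v <= s)%N -> y0 <= y s) ->
  (P (\bigcup_i [set w | deviates f v l y (G (v + i) w)])
    <= (expR (2 * l ^+ 2 * P2 - y0))%:E)%E.
Proof.
move=> l0 yy0; apply: le_probability_bigcup.
- by move=> i; exact: measurable_graph_in.
- move=> i j ij w /=; rewrite !deviates_graph ?leq_addr// => dev.
  have ij' : (v + i <= v + j)%N by rewrite leq_add2l.
  by have [F + _] := graph_prefix m X w ij'; rewrite -/G => ->; apply: ever_cat.
move=> i.
have := @probability_graph_le _ _ _ _ m X f f_gt0 hX (v + i)
  (deviates f v l y) pred0 pred0 0 0 (expR (2 * l ^+ 2 * P2 - y0)).
rewrite !mul0e !add0e; apply; rewrite ?lexx ?expR_ge0//.
move=> w /=; rewrite !mul0r !add0r.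
rewrite (sorted_split v (sources_sorted m (v + i) w)).
apply: le_trans (expect_deviates_le f_gt0 f_ndecr Phi2_le y l0 _ _) _.
- by apply/allP => k; rewrite mem_filter => /andP[].
- by apply/allP => k; rewrite mem_filter => /andP[].
rewrite ler_expR lerB// yy0// size_filter (count_sources m X)//.
  exact: leq_size_graph.
exact: leq_addr.
Qed.

(** The exponent - f(0)/2 is the most negative one allowed. *)
Lemma ae_lower_deviation v : {ae P, forall w, exists y : R,
  forall N, (v <= N)%N -> ~~ deviates f v (- (f 0%N / 2)) (fun=> y) (G N w)}.
Proof.
pose D (y : R) : set T :=
  \bigcup_i [set w | deviates f v (- (f 0%N / 2)) (fun=> y) (G (v + i) w)].
have mD y : measurable (D y).
  by apply: bigcupT_measurable => i; exact: measurable_graph_in.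
have mA : measurable (\bigcap_(y : nat) D y%:R) by exact: bigcapT_measurable.
exists (\bigcap_(y : nat) D y%:R); split => //.
  apply: (probability0_of_le (C := 2 * (- (f 0%N / 2)) ^+ 2 * P2)) => // y.
  apply: (@le_trans _ _ (P (D y%:R))).
    by apply: le_probability => // w; apply.
  exact: (probability_deviates (lexx _) (fun _ _ => lexx y%:R)).
move=> w /= nw y _; apply: contrapT => nD; apply: nw; exists y%:R => N vN.
by apply/negP => dev; apply: nD; exists (N - v)%N => //=; rewrite subnKC.
Qed.

Lemma drift_graph_lt v (l : R) (y : nat -> R) N w : (v <= N)%N ->
  ~~ deviates f v l y (G N w) ->
  drift f v l (G N w) < drift f v l (G v w) + y (size (G v w)).
Proof.
move=> vN; rewrite deviates_graph// ltNge; apply: contra => dev.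
apply: ever_now; rewrite dev andbT; have [F + _] := graph_prefix m X w vN.
by rewrite -/G => ->; rewrite size_cat leq_addr.
Qed.

Lemma ae_Phi_clock v : {ae P, forall w, exists C : R,
  forall N, (v <= N)%N ->
    clock f (G N w) - C < Phi f 1 (degree (G N w) v)}.
Proof.
apply: filterS (ae_lower_deviation v) => w [y dev].
have l0 : 0 < f 0%N / 2 by rewrite divr_gt0.
exists (((- (f 0%N / 2)) * (Phi f 1 (degree (G v w) v) - clock f (G v w)) + y)
  / (f 0%N / 2)) => N vN.
have := drift_graph_lt vN (dev N vN); rewrite /drift.
set c := _ * (Phi _ _ (degree (G v w) v) - _) + y.
rewrite mulNr ltrNl -mulNr => H.
suff : clock f (G N w) - Phi f 1 (degree (G N w) v) < c / (f 0%N / 2) by lra.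
by rewrite ltr_pdivlMr// mulrC; lra.
Qed.

(** With exponent 2/c and threshold 2 log(s), an excess of c log(s) over the clock has
    probability O(s^-2), and at least v edges precede the birth of v_v. *)
Lemma ae_upper_deviation (c : R) : 0 < c ->
  {ae P, forall w, exists n0, forall v N, (n0 <= v)%N -> (v <= N)%N ->
    ~~ deviates f v (2 / c) (fun s => 2 * ln s%:R) (G N w)}.
Proof.
move=> c0; pose D v : set T := \bigcup_i
  [set w | deviates f v (2 / c) (fun s => 2 * ln s%:R) (G (v + i) w)].
have mD v : measurable (D v).
  by apply: bigcupT_measurable => i; exact: measurable_graph_in.
pose C : R := expR (2 * (2 / c) ^+ 2 * P2).
have PD v : (P (D v) <= (C * expR (- (2 * ln v%:R)))%:E)%E.
  rewrite -expRD; apply: probability_deviates => //.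
    by apply: (@le_trans _ _ 0); rewrite ?oppr_le0 divr_ge0// ltW.
  move=> s vs; rewrite ler_pM2l//; case: v vs => [|v] vs.
    rewrite ln0//; case: s vs => [|s] _; first by rewrite ln0.
    by rewrite ln_ge0// ler1n.
  by rewrite ler_ln ?posrE ?ltr0n ?ler_nat//; lia.
have sumD : (\sum_(0 <= v <oo) P (D v) < +oo)%E.
  apply: (@le_lt_trans _ _ (C * 3)%:E); last exact: ltry.
  apply: lime_le; first exact: is_cvg_nneseries.
  apply: nearW => n.
  apply: (@le_trans _ _ (\sum_(0 <= v < n) (C * expR (- (2 * ln v%:R)))%:E)%E).
    by apply: lee_sum => v _; exact: PD.
  by rewrite sumEFin lee_fin -mulr_sumr ler_pM2l ?expR_gt0// sum_expR_ln_le.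
have limD := lim_sup_set_cvg0 mD sumD.
exists (lim_sup_set D); split => //.
  apply: bigcapT_measurable => n; apply: bigcup_measurable => k _; exact: mD.
move=> w /= nw n _; apply: contrapT => nD; apply: nw; exists n => v N nv vN.
apply/negP => dev; apply: nD; exists v => //=; exists (N - v)%N => //=.
by rewrite subnKC.
Qed.

End DegreeDeviations.

Section AlmostSureGrowth.
Context {d : measure_display} {T : measurableType d} {R : realType}.
Context {P : probability T R}.
Variables (m : nat -> {RV P >-> nat}) (X : nat -> nat -> {RV P >-> nat}).
Context (f : nat -> R) (f_gt0 : forall i, 0 < f i).
Context (f_ndecr : {homo f : i j / (i <= j)%N >-> i <= j}).
Context (P2 : R) (Phi2_le : forall a, Phi f 2 a <= P2).
Context (Cf : R) (Cf_gt0 : 0 < Cf) (f_le : forall i, f i <= Cf * i.+1%:R).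
Context (m_gt0 : forall i w, (0 < i)%N -> (0 < m i w)%N).
Hypothesis hX : preferential_attachment m X f.
Let G := graph m X.

Lemma clock_graph_ge N w : ln (size (G N w)).+1%:R / (3 * Cf) <= clock f (G N w).
Proof.
apply: clock_ge => // t tG; have tS : (t < size (sources m N w))%N.
  by rewrite -(size_graph m X).
have [_ nt _ _ _] := graph_step X tS.
have -> : (nth (0, 0) (G N w) t).1 = (nth 0 (sources m N w) t).+1.
  rewrite -(nth_map _ 0 fst)// -/(unzip1 _) /G unzip1_graph.
  by rewrite (nth_map 0).
by apply: leq_trans nt; exact: leq_size_graph.
Qed.

Lemma ae_degree_unbounded v : {ae P, forall w, forall K, exists2 N0, (v <= N0)%N &
  forall N, (N0 <= N)%N -> (K <= degree (G N w) v)%N}.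
Proof.
apply: filterS (ae_Phi_clock f_gt0 f_ndecr Phi2_le m_gt0 hX v) => w [C HC] K.
pose x := expR (3 * Cf * (C + Phi f 1 K)).
pose N0 := maxn v (Num.bound x); exists N0; first exact: leq_maxl.
move=> N N0N; rewrite leqNgt; apply/negP => degK.
have vN : (v <= N)%N by apply: leq_trans N0N; exact: leq_maxl.
have := HC N vN; apply/negP; rewrite -leNgt.
apply: le_trans (le_Phi f_gt0 1 (ltnW degK)) _.
rewrite lerBrDr addrC.
apply: le_trans (clock_graph_ge N w); rewrite ler_pdivlMr ?mulr_gt0// mulrC.
rewrite -ler_expR lnK ?posrE//.
apply: le_trans (ltW (archi_boundP (expR_ge0 _))) _; rewrite ler_nat.
have := leq_size_graph X m_gt0 N w; rewrite -/G.
move=> NG; apply: leqW; apply: leq_trans NG; apply: leq_trans N0N.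
exact: leq_maxr.
Qed.

End AlmostSureGrowth.

(** * Almost sure finiteness of the number of ties *)

Section FinitelyManyTies.
Context {d : measure_display} {T : measurableType d} {R : realType}.
Context {P : probability T R}.
Variables (m : nat -> {RV P >-> nat}) (X : nat -> nat -> {RV P >-> nat}).
Context (f : nat -> R) (f_gt0 : forall i, 0 < f i).
Context (f_ndecr : {homo f : i j / (i <= j)%N >-> i <= j}).
Context (P2 : R) (Phi2_le : forall a, Phi f 2 a <= P2).
Context (tail_small : forall e : R, 0 < e -> exists a, tail f P2 a < e).
Context (Cf : R) (Cf_gt0 : 0 < Cf) (f_le : forall i, f i <= Cf * i.+1%:R).
Context (m_gt0 : forall i w, (0 < i)%N -> (0 < m i w)%N).
Hypothesis hX : preferential_attachment m X f.
Let G := graph m X.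

Lemma ever_graph Q n N w : (n <= N)%N -> ever Q (G n w) -> ever Q (G N w).
Proof.
by move=> nN; have [F + _] := graph_prefix m X w nN; rewrite -/G => ->; apply: ever_cat.
Qed.

Lemma low_graph u v K n N w : (n <= N)%N -> low u v K (G N w) -> low u v K (G n w).
Proof.
move=> nN; have [F + _] := graph_prefix m X w nN; rewrite -/G => ->.
rewrite /low; have := degree_take_le (size (G n w)) (G n w ++ F).
by rewrite take_size_cat// => dF /orP[] ?; apply/orP; [left|right];
  apply: leq_ltn_trans (dF _) _.
Qed.

(** This holds because degrees tend to infinity almost surely. There is no rate that
    is uniform over the sources, as the birth of [v] may come late. *)
Lemma probability_low u v K (e : R) : 0 < e -> exists n0, forall n, (n0 <= n)%N ->
  fine (P [set w | low u v K (G n w)]) < e.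
Proof.
move=> e0; pose L n := [set w | low u v K (G n w)].
have mL n : measurable (L n) by exact: measurable_graph_in.
have niL : {homo L : i j / (i <= j)%N >-> j `<=` i}.
  by move=> i j ij w; apply: low_graph.
have [n0 near0] := probability_bigcap_near P e0 mL niL.
suff P0 : P (\bigcap_n L n) = 0%E.
  by exists n0 => n /near0; rewrite P0 /= add0r.
have [S [mS S0 subS]] := filterI
  (ae_degree_unbounded f_gt0 f_ndecr Phi2_le Cf_gt0 f_le m_gt0 hX u)
  (ae_degree_unbounded f_gt0 f_ndecr Phi2_le Cf_gt0 f_le m_gt0 hX v).
apply: (subset_measure0 _ mS _ S0); first exact: bigcapT_measurable.
move=> w Lw; apply: subS => -[/(_ K)[Nu _ du] /(_ K)[Nv _ dv]].
have := Lw (maxn Nu Nv) I; rewrite /L /low /= -/G !ltnNge.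
by rewrite du ?leq_maxl// dv// leq_maxr.
Qed.

Lemma tie_inequality u v N K N' n : (u < v)%N ->
  let T1 := tied u v (fun d => (N <= d <= K)%N) in
  let T2 := tied u v (leq N') in
  (K < N')%N ->
  fine (P [set w | ever T1 (G n w)]) <=
    19 * fine (P [set w | ever T1 (G n w) && ~~ ever T2 (G n w)]) +
    2 / tail f P2 K * tail f P2 0 * fine (P [set w | low u v N' (G n w)]) +
    2 / tail f P2 K * tail f P2 N'.
Proof.
move=> uv T1 T2 KN'.
have t0 a : 0 < tail f P2 a := tail_gt0 f_gt0 Phi2_le a.
have c0 : 0 <= 2 / tail f P2 K by rewrite divr_ge0// ltW.
have mB (B : pred multigraph) : measurable [set w | B (G n w)].
  exact: measurable_graph_in.
have := @probability_graph_le _ _ _ _ m X f f_gt0 hX n (ever T1)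
  (fun F => ever T1 F && ~~ ever T2 F) (low u v N') 19
  (2 / tail f P2 K * tail f P2 0) (2 / tail f P2 K * tail f P2 N').
rewrite -/G -(EFin_fine_probability (mB (ever T1))).
rewrite -(EFin_fine_probability (mB (fun F => ever T1 F && ~~ ever T2 F))).
rewrite -(EFin_fine_probability (mB (low u v N'))).
rewrite -!EFinM -!EFinD lee_fin; apply.
- by [].
- by rewrite mulr_ge0// ltW.
- by rewrite mulr_ge0// ltW.
move=> w /=.
have := @first_tie_escape R f f_gt0 P2 Phi2_le u v N K N' (sources m n w) [::]
  uv KN' (sources_sorted m n w).
have nb : born v [::] -> all (leq v) (sources m n w) by [].
move=> /(_ nb); rewrite /= ever_nil => /(_ id) /le_trans; apply.
rewrite expectD expectZ expectZ expectD expectZ expect_cst//; lra.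
Qed.

(** Let A be the event of ties at unbounded degrees, and e = P(A)/43. With N, then K,
    N' and n large, P(A) < P(tie at a degree in [N, K]) + 2 e, and by
    [tie_inequality] this probability is at most 19 times that of a tie above N but
    none above N', plus 2 e. That event has probability at most 2 e since ties above
    N and ties above N' both have almost the probability of A. So P(A) < 42 e. *)
Lemma ae_finitely_many_ties u v : (u < v)%N ->
  {ae P, forall w, exists N0, forall n, ~~ ever (tied u v (leq N0)) (G n w)}.
Proof.
move=> uv; pose Tn N n : set T := [set w | ever (tied u v (leq N)) (G n w)].
pose TKn N K n : set T :=
  [set w | ever (tied u v (fun d => (N <= d <= K)%N)) (G n w)].
pose TN N := \bigcup_n Tn N n; pose TK N K := \bigcup_n TKn N K n.
pose A := \bigcap_N TN N.
have mTn N n : measurable (Tn N n) by exact: measurable_graph_in.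
have mTKn N K n : measurable (TKn N K n) by exact: measurable_graph_in.
have mTN N : measurable (TN N) by exact: bigcupT_measurable.
have mTK N K : measurable (TK N K) by exact: bigcupT_measurable.
have mA : measurable A by exact: bigcapT_measurable.
have ndTn N : {homo Tn N : i j / (i <= j)%N >-> i `<=` j}.
  by move=> i j ij w; apply: ever_graph.
have ndTKn N K : {homo TKn N K : i j / (i <= j)%N >-> i `<=` j}.
  by move=> i j ij w; apply: ever_graph.
have ever_sub (I J : pred nat) F : (forall x, I x -> J x) ->
    ever (tied u v I) F -> ever (tied u v J) F.
  move=> IJ /everP[j jF /and3P[b e Ij]]; apply/everP; exists j => //.
  by apply/and3P; split => //; exact: IJ.
have niTN : {homo TN : i j / (i <= j)%N >-> j `<=` i}.
  move=> i j ij w [n _ wn]; exists n => //; apply: ever_sub wn => x.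
  exact: leq_trans.
have ndTK N : {homo TK N : i j / (i <= j)%N >-> i `<=` j}.
  move=> i j ij w [n _ wn]; exists n => //; apply: ever_sub wn => x /andP[-> xi].
  exact: leq_trans xi ij.
have TKN N : TN N `<=` \bigcup_K TK N K.
  move=> w [n _ /everP[j jn /and3P[b e Nj]]].
  exists (degree (take j (G n w)) u) => //; exists n => //.
  by apply/everP; exists j => //; apply/and3P; split => //; rewrite Nj leqnn.
pose pr (S : set T) := fine (P S).
have le_pr (S S' : set T) : measurable S -> measurable S' -> S `<=` S' -> pr S <= pr S'.
  by move=> mS mS' SS'; rewrite fine_le ?fin_num_measure//; exact: le_probability.
have AP : P A = 0%E.
  rewrite -(EFin_fine_probability mA) -/(pr A); congr EFin.
  apply/eqP; rewrite eq_le fine_ge0// andbT leNgt; apply/negP => a0.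
  pose e := pr A / 43; have e0 : 0 < e by rewrite divr_gt0.
  have [N /(_ N (leqnn N))] := probability_bigcap_near P e0 mTN niTN.
  rewrite -/A -/(pr A) -/(pr _) => prN.
  have [K /(_ K (leqnn K))] := probability_bigcup_near P e0 (mTK N) (ndTK N).
  rewrite -/(pr _) -/(pr (TK N K)) => prK.
  have t0 a : 0 < tail f P2 a := tail_gt0 f_gt0 Phi2_le a.
  pose c := 2 / tail f P2 K; have c0 : 0 < c by rewrite divr_gt0.
  have [b tb] := tail_small (divr_gt0 e0 c0).
  pose N' := maxn (maxn b N) K.+1.
  have tN' : c * tail f P2 N' < e.
    rewrite mulrC -ltr_pdivlMr//; apply: le_lt_trans tb.
    by apply: le_tail => //; rewrite /N' !leq_max leqnn.
  have KN' : (K < N')%N by exact: leq_maxr.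
  have ct0 : 0 < c * tail f P2 0 by rewrite mulr_gt0.
  have [n1 near1] := probability_low u v N' (divr_gt0 e0 ct0).
  have [n2 near2] := probability_bigcup_near P e0 (mTKn N K) (ndTKn N K).
  have [n3 near3] := probability_bigcup_near P e0 (mTn N') (ndTn N').
  pose n := maxn n1 (maxn n2 n3).
  have {near1} : pr [set w | low u v N' (G n w)] < e / (c * tail f P2 0).
    by apply: near1; exact: leq_maxl.
  rewrite ltr_pdivlMr// => pr1.
  have {near2} : pr (TK N K) < pr (TKn N K n) + e.
    by apply: near2; rewrite /n !leq_max leqnn orbT.
  have {near3} : pr (TN N') < pr (Tn N' n) + e.
    by apply: near3; rewrite /n !leq_max leqnn !orbT.
  have := @tie_inequality u v N K N' n uv KN'.
  set D := [set w | _ && _]; rewrite -/(pr _) -/(pr D) -/(pr [set w | low _ _ _ _]).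
  rewrite -/(TKn N K n) -/c => ineq pr3 pr2.
  have NN' : (N <= N')%N by rewrite /N' !leq_max leqnn orbT.
  have mD : measurable D.
    rewrite (_ : D = TKn N K n `\` Tn N' n); first exact: measurableD.
    apply/seteqP; split => w; first by move=> /andP[T1w /negP].
    by move=> [T1w /negP nT2w]; apply/andP.
  have prD : pr D <= pr (TN N) - pr (Tn N' n).
    have TT : Tn N' n `<=` TN N by move=> w wn; apply: (niTN _ _ NN'); exists n.
    have mS : measurable (TN N `\` Tn N' n) by exact: measurableD.
    apply: (@le_trans _ _ (pr (TN N `\` Tn N' n))).
      apply: le_pr => // w /andP[T1w nT2w]; split; last by move/negP: nT2w.
      by exists n => //; apply: ever_sub T1w => x /andP[].
    have : P (TN N) = (P (TN N `\` Tn N' n) + P (TN N `&` Tn N' n))%E.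
      exact: measureDI.
    rewrite (setIidr TT) -(EFin_fine_probability (mTN N)).
    rewrite -(EFin_fine_probability mS) -(EFin_fine_probability (mTn N' n)).
    by rewrite -EFinD => -[]; rewrite -!/(pr _); lra.
  have prA : pr A <= pr (TN N') by apply: le_pr => // w; apply.
  have prAN : pr A <= pr (TN N) by apply: le_pr => // w; apply.
  have prTN : pr (TN N) <= pr (\bigcup_K TK N K).
    by apply: le_pr => //; exact: bigcupT_measurable.
  have eE : 43 * e = pr A by rewrite /e mulrC divfK.
  lra.
exists A; split => // w /= nw N _; apply: contrapT => nT; apply: nw.
by exists N => n; apply/negP => tie; apply: nT; exists n.
Qed.
End FinitelyManyTies.

(** * Persistence of the hub *)

Lemma limn_esup_lt {R : realType} (u : (\bar R)^nat) (y : \bar R) :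
  (limn_esup u < y)%E -> exists n0, forall n, (n0 <= n)%N -> (u n < y)%E.
Proof.
move=> /ereal_inf_lt[_ [A [n0 _ An] <-] Ay]; exists n0 => n n0n.
by apply: le_lt_trans Ay; apply: ereal_sup_ubound; exists n => //; exact: An.
Qed.

Lemma Phi2_bounded {R : realType} (f : nat -> R) : (forall i, 0 < f i) ->
  (Phi_infty f 2 < +oo)%E -> exists2 P2, forall a, Phi f 2 a <= P2 &
    forall e, 0 < e -> exists a, tail f P2 a < e.
Proof.
move=> f_gt0.
have ndPhi : {homo (fun l => (Phi f 2 l)%:E) : a b /
    (a <= b)%N >-> (a <= b)%E}.
  by move=> a b ab; rewrite lee_fin le_Phi.
rewrite /Phi_infty (cvg_lim _ (ereal_nondecreasing_cvgn ndPhi))//.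
set s := ereal_sup _ => s_lt.
have sfin : s \is a fin_num.
  rewrite fin_real// s_lt andbT; apply: lt_le_trans (ltNyr (Phi f 2 0)) _.
  by apply: ereal_sup_ubound; exists 0%N.
exists (fine s) => [a|e e0].
  by rewrite -lee_fin fineK//; apply: ereal_sup_ubound; exists a.
have [_ [a _ <-]] := ub_ereal_sup_adherent e0 sfin.
by rewrite -/s -(fineK sfin) -EFinB lte_fin => H; exists a; rewrite /tail; lra.
Qed.

(** The edge can hit only one of two vertices, so a strict order of degrees can only be
    reversed through a tie. *)
Lemma tie_free_order u v N (E F : multigraph) : (u < v)%N -> born v E ->
  (N <= degree E u)%N -> all (fun e => v < e.1)%N F ->
  ~~ ever (tied u v (leq N)) (E ++ F) ->
  (degree (E ++ F) u < degree (E ++ F) v)%N = (degree E u < degree E v)%N.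
Proof.
move=> uv bE NE; elim/last_ind: F => [|F e ih] vF; first by rewrite cats0.
rewrite -rcons_cat ever_rcons negb_or => /andP[nEF nT].
move: vF; rewrite all_rcons => /andP[ve vF]; rewrite -(ih vF nEF).
have NEF : (N <= degree (E ++ F) u)%N.
  apply: leq_trans NE _; have := degree_take_le (size E) (E ++ F) u.
  by rewrite take_size_cat.
have untied E' : born v E' -> (N <= degree E' u)%N -> ~~ tied u v (leq N) E' ->
    (degree E' u == degree E' v) = false.
  by move=> bE' NE'; rewrite /tied bE' NE' andbT => /negPf.
have bEF : born v (E ++ F) by rewrite /born has_cat -/(born v E) bE.
have := untied _ bEF NEF (contra (@ever_now _ _) nEF).
case: e ve nT => a i /= ve nT; have := untied _ _ _ nT.
rewrite /born has_rcons -/(born v _) bEF orbT !degree_rcons => /(_ isT).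
have -> : (a == u) = false by apply/eqP; lia.
have -> : (a == v) = false by apply/eqP; lia.
rewrite !addn0 => /(_ (leq_trans NEF (leq_addr _ _))).
by case: (eqVneq i u) => [->|iu]; case: (eqVneq _ v) => [iv|iv] /=; lia.
Qed.

Section Hub.
Context {d : measure_display} {T : measurableType d} {R : realType}.
Context {P : probability T R}.
Variables (m : nat -> {RV P >-> nat}) (X : nat -> nat -> {RV P >-> nat}).
Context (f : nat -> R) (f_gt0 : forall i, 0 < f i).
Context (m_gt0 : forall i w, (0 < i)%N -> (0 < m i w)%N).
Let G := graph m X.

(** The targets of edges are unconstrained on a null set of the model. *)
Lemma ae_targets : preferential_attachment m X f ->
  {ae P, forall w N, all (fun e => e.2 < e.1)%N (G N w)}.
Proof.
move=> hX; apply: ae_foralln => N.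
pose B E := all (fun e : nat * nat => e.2 < e.1)%N E.
exists [set w | ~~ B (G N w)]; split; last by move=> w /negP.
  exact: (measurable_pred (predC B) (preimage_measurable_graph m X N)).
apply/eqP; rewrite eq_le measure_ge0 andbT.
have := @probability_graph_le _ _ _ _ m X f f_gt0 hX N (predC B) pred0 pred0 0 0 0.
rewrite !mul0e !add0e; apply; rewrite ?lexx// => w /=; rewrite !mul0r !add0r.
rewrite -[leRHS](expect_cst f_gt0 (sources m N w) 0 [::]).
by apply: ler_expect_ext => // F _ F21; rewrite /B /= F21.
Qed.

(** Hence Phi_1(m_n) is the initial value for v_n. *)
Lemma degree_at_birth n w : (0 < n)%N ->
  all (fun e => e.2 < e.1)%N (G n w) -> degree (G n w) n = m n w.
Proof.
case: n => // n _ G21; have G1 : all (fun e => e.1 <= n.+1)%N (G n.+1 w).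
  apply/allP => e eG; have : e.1 \in unzip1 (G n.+1 w) by apply: map_f.
  by rewrite unzip1_graph => /mapP[k /sources_lt kn ->].
rewrite /degree /indeg (_ : count _ _ = 0%N) ?add0n; last first.
  apply/eqP; rewrite -leqn0 leqNgt -has_count; apply/hasPn => e eG.
  have := allP G21 _ eG; have := allP G1 _ eG => /= e1 e2.
  by apply/eqP; lia.
rewrite /outdeg /G /= count_cat (_ : count _ (graph m X n w) = 0%N) ?add0n.
  by rewrite count_map (eq_count (a2 := predT)) ?count_predT ?size_iota// => k /=;
    rewrite eqxx.
apply/eqP; rewrite -leqn0 leqNgt -has_count; apply/hasPn => e eG.
have : e.1 \in unzip1 (graph m X n w) by apply: map_f.
by rewrite unzip1_graph => /mapP[k /sources_lt kn ->]; apply/eqP; lia.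
Qed.

Lemma size_graph_partial_sum n w : size (G n w) = partial_sum m n w.
Proof.
rewrite /partial_sum; elim: n => [|n ih]; first by rewrite big_geq.
by rewrite big_nat_recr//= -ih size_cat size_map size_iota.
Qed.

Lemma born_graph v N w : (v < N)%N -> born v (G N w).
Proof.
move=> vN; have [F + _] := graph_prefix m X w vN; rewrite -/G => ->.
rewrite /born has_cat; apply/orP; left; rewrite /G /= has_cat; apply/orP; right.
have := m_gt0 w (ltn0Sn v); case: (m v.+1 w) => //= k _.
by rewrite ltnSn.
Qed.

Lemma eventually_ordered u v N w : (u < v)%N ->
  (forall n, ~~ ever (tied u v (leq N)) (G n w)) ->
  (exists n0, forall n, (n0 <= n)%N -> (N <= degree (G n w) u)%N) ->
  exists n0,
    (forall n, (n0 <= n)%N -> (degree (G n w) u <= degree (G n w) v)%N) \/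
    (forall n, (n0 <= n)%N -> (degree (G n w) v <= degree (G n w) u)%N).
Proof.
move=> uv noties [n1 degN]; pose n0 := maxn n1 v.+1; exists n0.
have key n : (n0 <= n)%N -> (degree (G n w) u < degree (G n w) v)%N =
    (degree (G n0 w) u < degree (G n0 w) v)%N.
  move=> n0n; have [F GF nF] := graph_prefix m X w n0n; have := noties n.
  rewrite /G GF -/G; apply: tie_free_order => //.
  - by apply: born_graph; exact: leq_maxr.
  - by apply: degN; exact: leq_maxl.
  - apply: sub_all nF => e; apply: leq_trans.
    by rewrite ltnS (leq_trans _ (leq_maxr n1 v.+1))// .
have [lt|ge] := boolP (degree (G n0 w) u < degree (G n0 w) v)%N;
  [left|right] => n n0n.
  by rewrite ltnW// key.
by rewrite leqNgt key.
Qed.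

(** The finitely many vertices up to [n1] are eventually totally ordered by degree,
    and all the others stay below v_0. *)
Lemma hub_of_eventual_order w n1 :
  (forall n N, (n1 <= n)%N -> (n <= N)%N ->
    (degree (G N w) n <= degree (G N w) 0)%N) ->
  (forall u v, (u < v)%N -> exists n0,
    (forall n, (n0 <= n)%N -> (degree (G n w) u <= degree (G n w) v)%N) \/
    (forall n, (n0 <= n)%N -> (degree (G n w) v <= degree (G n w) u)%N)) ->
  exists n0 v : nat, forall n, (n0 <= n)%N -> has_max_degree m X n w v.
Proof.
move=> late ordered.
have best k : exists n0 v : nat, (v <= k)%N /\
    forall n u, (n0 <= n)%N -> (u <= k)%N ->
    (degree (G n w) u <= degree (G n w) v)%N.
  elim: k => [|k [n0 [v [vk best]]]].
    by exists 0%N, 0%N; split => // n u _; rewrite leqn0 => /eqP->.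
  have [n2 ord] := ordered v k.+1 vk; exists (maxn n0 n2).
  case: ord => ord; [exists k.+1|exists v]; (split; first by lia) => n u;
      rewrite geq_max => /andP[n0n n2n] uk1.
  - have [->//|uk] := eqVneq u k.+1.
    by apply: leq_trans (ord _ n2n); apply: best => //; lia.
  - have [->|uk] := eqVneq u k.+1; first exact: ord.
    by apply: best => //; lia.
have [n0 [v [vn best1]]] := best n1.
exists (maxn n0 n1), v => n; rewrite geq_max => /andP[n0n n1n].
split=> [|u un]; first exact: leq_trans vn n1n.
have [un1|n1u] := leqP u n1; first exact: best1.
exact: leq_trans (late u n (ltnW n1u) un) (best1 n 0%N n0n (leq0n _)).
Qed.

End Hub.

Section Final.
Context {d : measure_display} {T : measurableType d} {R : realType}.
Context {P : probability T R}.
Variables (m : nat -> {RV P >-> nat}) (X : nat -> nat -> {RV P >-> nat}).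
Context (f : nat -> R) (f_gt0 : forall i, 0 < f i).
Context (Cf : R) (Cf_gt0 : 0 < Cf) (f_le : forall i, f i <= Cf * i.+1%:R).
Context (m_gt0 : forall i w, (0 < i)%N -> (0 < m i w)%N).
Let G := graph m X.

(** The drift bounds for v_n from its birth on and for v_0, compared as explained at
    the top: 1/4 + 1/24 - 1/3 = - 1/24 must outweigh the constant [C] of v_0. *)
Lemma late_vertices_below w (C : R) :
  (forall N, all (fun e => e.2 < e.1)%N (G N w)) ->
  (limn_esup (fun n => (Phi f 1 (m n w) / ln (partial_sum m n w)%:R)%:E)
     <= (1 / (8 * Cf))%:E)%E ->
  (exists n0, forall v N, (n0 <= v)%N -> (v <= N)%N ->
     ~~ deviates f v (2 / (24 * Cf)^-1) (fun s => 2 * ln s%:R) (G N w)) ->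
  (forall N, clock f (G N w) - C < Phi f 1 (degree (G N w) 0)) ->
  exists n1, forall n N, (n1 <= n)%N -> (n <= N)%N ->
    (degree (G N w) n <= degree (G N w) 0)%N.
Proof.
move=> G21 m_limsup [n0 dev] HC.
have C8 : 1 / (8 * Cf) < 1 / (4 * Cf).
  by rewrite !div1r ltf_pV2 ?posrE ?mulr_gt0// ltr_pM2r// ltr_nat.
have [n2 mlt] := limn_esup_lt (le_lt_trans m_limsup (etrans (lte_fin _ _) C8)).
pose x := expR (24 * Cf * C).
exists (maxn (maxn n0 n2) (maxn 2 (Num.bound x))) => n N.
rewrite !geq_max => /andP[/andP[n0n n2n] /andP[n_ge2 xn]] nN.
set s := size (G n w); have ns : (n <= s)%N by exact: leq_size_graph.
have s1 : 1 < s%:R :> R by rewrite ltr1n; lia.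
have ln0 : 0 < ln s%:R :> R by rewrite ln_gt0.
have Phim : Phi f 1 (m n w) <= ln s%:R / (4 * Cf).
  have := mlt n n2n; rewrite lte_fin -(size_graph_partial_sum m X) -/s.
  by rewrite ltr_pdivrMr// => /ltW; rewrite mul1r mulrC.
have lnC : C <= ln s%:R / (24 * Cf).
  rewrite ler_pdivlMr ?mulr_gt0// mulrC -ler_expR lnK ?posrE; last lra.
  apply: le_trans (ltW (archi_boundP (expR_ge0 _))) _; rewrite ler_nat.
  exact: leq_trans xn ns.
have clock_n : ln s%:R / (3 * Cf) <= clock f (G n w).
  apply: le_trans (clock_graph_ge X f_gt0 Cf_gt0 f_le m_gt0 n w).
  rewrite ler_pM2r ?invr_gt0 ?mulr_gt0// ler_ln ?posrE; [|lra|by rewrite ltr0n].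
  by rewrite ler_nat.
have := drift_graph_lt nN (dev n N n0n nN); rewrite /drift -/s.
rewrite (degree_at_birth (X := X))//; last by lia.
have l0 : 0 < 2 / (24 * Cf)^-1 by rewrite divr_gt0// invr_gt0 mulr_gt0.
have -> : 2 * ln s%:R = 2 / (24 * Cf)^-1 * (ln s%:R / (24 * Cf)).
  by field; rewrite gt_eqF.
rewrite -mulrDr ltr_pM2l// => drift_n.
apply/ltnW; apply: (Phi_lt_inv f_gt0 (k := 1)).
have CfE a : ln s%:R / (a * Cf) = ln s%:R / Cf / a by rewrite invfM mulrA mulrAC.
move: Phim lnC clock_n drift_n; rewrite !CfE.
set y := ln s%:R / Cf => Phim lnC clock_n drift_n.
have := HC N; lra.
Qed.

End Final.

Theorem theorem4p2 (R : realType) (f : nat -> R) (Cf : R)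
    (d : measure_display) (T : measurableType d) (P : probability T R)
    (m : nat -> {RV P >-> nat}) (X : nat -> nat -> {RV P >-> nat})
    (f_gt0 : forall i, 0 < f i)
    (f_att : attachment_function f)
    (f_ndecr : {homo f : i j / (i <= j)%N >-> i <= j})
    (Cf_gt0 : 0 < Cf)
    (f_le : forall i, f i <= Cf * (i.+1)%:R)
    (Phi2_fin : (Phi_infty f 2 < +oo)%E)
    (m_gt0 : forall i w, (0 < i)%N -> (0 < m i w)%N)
    (m_limsup : {ae P, forall w,
       (limn_esup (fun n => (Phi f 1 (m n w) / ln (partial_sum m n w)%:R)%:E)
          <= (1 / (8 * Cf))%:E)%E})
    (hX : preferential_attachment m X f) :
  persistent_hub m X.
Proof.
have [P2 Phi2_le tail_small] := Phi2_bounded f_gt0 Phi2_fin.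
have c0 : 0 < (24 * Cf)^-1 by rewrite invr_gt0 mulr_gt0.
have upper := ae_upper_deviation f_gt0 f_ndecr Phi2_le m_gt0 hX c0.
have lower := ae_Phi_clock f_gt0 f_ndecr Phi2_le m_gt0 hX 0.
have degrees : {ae P, forall w, forall v K, exists2 N0, (v <= N0)%N &
    forall N, (N0 <= N)%N -> (K <= degree (graph m X N w) v)%N}.
  apply: ae_foralln => v.
  exact: (ae_degree_unbounded f_gt0 f_ndecr Phi2_le Cf_gt0 f_le m_gt0 hX v).
have ties : {ae P, forall w, forall u v, (u < v)%N -> exists N0, forall n,
    ~~ ever (tied u v (leq N0)) (graph m X n w)}.
  apply: ae_foralln => u; apply: ae_foralln => v; have [uv|vu] := ltnP u v.
    have := ae_finitely_many_ties f_gt0 f_ndecr Phi2_le tail_small Cf_gt0 f_le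
      m_gt0 hX uv.
    by apply: filterS => w N0 _.
  by apply: nearW => w uv; exfalso; move: uv.
have ordered : {ae P, forall w u v, (u < v)%N -> exists n0,
    (forall n, (n0 <= n)%N ->
       (degree (graph m X n w) u <= degree (graph m X n w) v)%N) \/
    (forall n, (n0 <= n)%N ->
       (degree (graph m X n w) v <= degree (graph m X n w) u)%N)}.
  apply: filterS2 degrees ties => w deg noties u v uv.
  have [N0 nt] := noties u v uv; have [n0 _ degu] := deg u N0.
  by apply: (eventually_ordered m_gt0 uv nt); exists n0.
have late : {ae P, forall w, exists n1, forall n N, (n1 <= n)%N -> (n <= N)%N ->
    (degree (graph m X N w) n <= degree (graph m X N w) 0)%N}.
  move: m_limsup; apply: filter_app.
  apply: filterS3 upper lower (ae_targets f_gt0 hX) => w dev [C HC] G21 limsup.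
  apply: (late_vertices_below f_gt0 Cf_gt0 f_le m_gt0 G21 limsup dev) => N.
  exact: HC.
apply: filterS2 late ordered => w [n1 late_w] ordered_w.
exact: (hub_of_eventual_order late_w ordered_w).
Qed.
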